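(* For $f\in L^\infty(\mathbb{R})$ let $\Phi_f=\Omega_f-\Psi_f$ and write the Fourier transform as $\hat f=\mathcal{F}[f]=\Omega_f''-\Psi_f''$, with $\Omega_f,\Psi_f$ as in the context. (a) For each $f\in L^\infty(\mathbb{R})$ and each $\phi\in\mathcal{S}(\mathbb{R})$, $\langle\hat f,\phi\rangle=\langle f,\hat\phi\rangle$. (b) Let $\mathcal{A}_\infty(\mathbb{R})=\{\hat f\mid f\in L^\infty(\mathbb{R})\}$, with norm defined by $\|\hat f\|_{\mathcal{A}}=\|f\|_\infty$. Then $\mathcal{F}:L^\infty(\mathbb{R})\to\mathcal{A}_\infty(\mathbb{R})$ is an isometric isomorphism. (c) Let $\mathcal{B}_\infty(\mathbb{R})=\{\Phi_f\mid f\in L^\infty(\mathbb{R})\}$, with norm defined by $\|\Phi_f\|_{\mathcal{B}}=\|f\|_\infty$. Then the three Banach spaces $L^\infty(\mathbb{R})$, $\mathcal{A}_\infty(\mathbb{R})$ and $\mathcal{B}_\infty(\mathbb{R})$ are isometrically isomorphic.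
   Context: Functions are complex-valued. $\mathcal{S}(\mathbb{R})$ is the Schwartz space; for $\phi\in\mathcal{S}(\mathbb{R})$, $\hat\phi(t)=\int_{-\infty}^\infty e^{-ist}\phi(s)\,ds$, and $\langle f,\hat\phi\rangle=\int_{-\infty}^\infty f(t)\hat\phi(t)\,dt$. For $f\in L^\infty(\mathbb{R})$ write $f=f_1+f_2$ with $f_1=f\chi_{[-1,1]}$, $f_2=f\chi_{\mathbb{R}\setminus[-1,1]}$. Put $\hat f_1(s)=\int_{-1}^1e^{-ist}f(t)\,dt$, $\Omega_f(s)=\int_0^s\int_0^{\sigma_2}\hat f_1(\sigma_1)\,d\sigma_1\,d\sigma_2$ (so $\Omega_f''=\hat f_1$), and $\Psi_f(s)=\int_{|t|>1}e^{-ist}f(t)\,\frac{dt}{t^2}$. All derivatives are distributional: $\langle T'',\phi\rangle=\langle T,\phi''\rangle$ for $\phi\in\mathcal{S}(\mathbb{R})$. The Fourier transform of $f$ is the tempered distribution $\hat f=\hat f_1-\Psi_f''$. *)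

(* Defs.v *)
From HB Require Import structures.
From mathcomp Require Import all_boot all_order all_algebra.
From mathcomp Require Import generic_quotient ring_quotient complex.
From mathcomp Require Import all_classical all_reals all_analysis.
From mathcomp Require Import measurable_realfun ess_sup_inf.

Set Implicit Arguments.
Unset Strict Implicit.
Unset Printing Implicit Defensive.
Import Order.TTheory GRing.Theory Num.Theory.
Import numFieldNormedType.Exports.
Import Normc.

Local Open Scope classical_set_scope.
Local Open Scope ring_scope.
Local Open Scope complex_scope.
Local Open Scope quotient_scope.

Section ComplexCalculus.
Context {R : realType}.
Local Notation mu := (@lebesgue_measure R).
Implicit Types (g : R -> R[i]) (D : set R).

Definition reF g : R -> R := fun x => complex.Re (g x).
Definition imF g : R -> R := fun x => complex.Im (g x).

(* Complex measurability, integrals and derivatives are taken componentwise. *)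
Definition Cmeasurable g : Prop :=
  measurable_fun [set: R] (reF g) /\ measurable_fun [set: R] (imF g).

Definition Cintegral D g : R[i] :=
  (\int[mu]_(x in D) reF g x) +i* (\int[mu]_(x in D) imF g x).

Definition oriented_Cintegral (a b : R) g : R[i] :=
  if a <= b then Cintegral `[a, b] g else - Cintegral `[b, a] g.

Definition Cderivable g (x : R) : Prop :=
  derivable (reF g) x 1 /\ derivable (imF g) x 1.

Definition Cderive g : R -> R[i] :=
  fun x => derive1 (reF g) x +i* derive1 (imF g) x.

(* cis x = exp (i x) *)
Definition cis (x : R) : R[i] := cos x +i* sin x.

Lemma reF_lin (a : R[i]) f g :
  reF (a *: f + g) =
  (complex.Re a \*: reF f) + (- complex.Im a \*: imF f) + reF g.
Proof.
apply/funext => x; rewrite /reF /imF !fctE/=.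
by case: a (f x) (g x) => [? ?] [? ?] [? ?] /=; rewrite ?scaleNr.
Qed.

Lemma imF_lin (a : R[i]) f g :
  imF (a *: f + g) =
  (complex.Re a \*: imF f) + (complex.Im a \*: reF f) + imF g.
Proof.
apply/funext => x; rewrite /reF /imF !fctE/=.
by case: a (f x) (g x) => [? ?] [? ?] [? ?] /=; rewrite ?scaleNr.
Qed.

Lemma Cmeasurable_lin (a : R[i]) f g :
  Cmeasurable f -> Cmeasurable g -> Cmeasurable (a *: f + g).
Proof.
move=> [mf1 mf2] [mg1 mg2]; split; rewrite (reF_lin, imF_lin).
- apply: measurable_funD => //; apply: measurable_funD;
  exact: measurable_funM.
- apply: measurable_funD => //; apply: measurable_funD;
  exact: measurable_funM.
Qed.

Lemma is_derive_lin (a b : R) (f g h : R -> R) (x : R) :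
  derivable f x 1 -> derivable g x 1 -> derivable h x 1 ->
  is_derive x 1 ((a \*: f) + (b \*: g) + h)
    (a * derive1 f x + b * derive1 g x + derive1 h x).
Proof.
move=> df dg dh; rewrite !derive1E.
have d1 := is_deriveZ a (DeriveDef df erefl).
have d2 := is_deriveZ b (DeriveDef dg erefl).
exact: is_deriveD (is_deriveD d1 d2) (DeriveDef dh erefl).
Qed.

Lemma Cderivable_lin (a : R[i]) f g x :
  Cderivable f x -> Cderivable g x -> Cderivable (a *: f + g) x.
Proof.
move=> [df1 df2] [dg1 dg2]; split; rewrite (reF_lin, imF_lin).
- by have [] := is_derive_lin (complex.Re a) (- complex.Im a) df1 df2 dg1.
- by have [] := is_derive_lin (complex.Re a) (complex.Im a) df2 df1 dg2.
Qed.

Lemma Cderive_lin (a : R[i]) f g :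
  (forall x, Cderivable f x) -> (forall x, Cderivable g x) ->
  Cderive (a *: f + g) = a *: Cderive f + Cderive g.
Proof.
move=> df dg; apply/funext => x; have [df1 df2] := df x; have [dg1 dg2] := dg x.
have [_ d1] := is_derive_lin (complex.Re a) (- complex.Im a) df1 df2 dg1.
have [_ d2] := is_derive_lin (complex.Re a) (complex.Im a) df2 df1 dg2.
rewrite /Cderive reF_lin imF_lin !derive1E d1 d2 !fctE !derive1E.
by case: a {d1 d2} => ? ? /=; rewrite mulNr.
Qed.

End ComplexCalculus.

Section Linfty.
Context {R : realType}.
Local Notation mu := (@lebesgue_measure R).
Implicit Types f g : R -> R[i].

Definition ess_norm f : \bar R := 'N[mu]_+oo[EFin \o (@normc R \o f)].

Lemma ae_mu_filter : Filter (nbhs (almost_everywhere mu)).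
Proof. exact: ae_filter_ringOfSetsType. Qed.
#[global] Existing Instance ae_mu_filter.

Lemma ess_norm_ltyP f :
  (ess_norm f < +oo)%E <-> exists M : R, \forall x \ae mu, normc (f x) <= M.
Proof.
have muT : (0 < mu [set: R])%E.
  by rewrite -set_itvNyy lebesgue_measure_itv/= adde_gt0.
rewrite /ess_norm unlock muT.
have -> : abse \o (EFin \o (@normc R \o f)) = EFin \o (@normc R \o f).
  apply/funext => x /=; congr _%:E; apply/ger0_norm.
  by case: (f x) => a b; exact: sqrtr_ge0.
split=> [/ess_supr_bounded[M HM]|[M HM]]; first by exists M.
apply: (@le_lt_trans _ _ M%:E); last exact: ltry.
by apply/ess_supP; move: HM; apply: filterS => x; rewrite /= lee_fin.
Qed.

Definition ess_bounded : {pred R -> R[i]} :=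
  [pred f | `[< Cmeasurable f /\ (ess_norm f < +oo)%E >]].

Lemma ess_bounded_submod : submod_closed ess_bounded.
Proof.
split.
  apply/asboolP; split; first by split; exact: measurable_cst.
  apply/ess_norm_ltyP; exists 0; apply: nearW => x.
  by rewrite /= expr0n/= addr0 sqrtr0.
move=> a f g /asboolP[mf /ess_norm_ltyP[M fM]] /asboolP[mg /ess_norm_ltyP[N gN]].
apply/asboolP; split; first exact: Cmeasurable_lin.
apply/ess_norm_ltyP; exists (normc a * M + N).
apply: filterS2 fM gN => x fM gN.
rewrite !fctE (le_trans (le_normcD _ _))// lerD//.
by rewrite normcM ler_wpM2l//; case: (a) => ? ?; exact: sqrtr_ge0.
Qed.

HB.instance Definition _ := GRing.isSubmodClosed.Build _ _ ess_bounded
  ess_bounded_submod.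

Record ess_bounded_fun := EssBoundedFun {
  ess_bounded_val :> R -> R[i] ;
  ess_bounded_valP : ess_bounded_val \in ess_bounded }.

HB.instance Definition _ := [isSub for ess_bounded_val].
HB.instance Definition _ := [Choice of ess_bounded_fun by <:].
HB.instance Definition _ := [SubChoice_isSubLmodule of ess_bounded_fun by <:].

Definition ae_zero : {pred ess_bounded_fun} :=
  [pred f : ess_bounded_fun | `[< \forall x \ae mu, f x = 0 >]].

Lemma ae_zero_submod : submod_closed ae_zero.
Proof.
split; first by apply/asboolP; apply: nearW.
move=> a f g /asboolP f0 /asboolP g0; apply/asboolP.
apply: filterS2 f0 g0 => x f0 g0.
have -> : (a *: f + g : ess_bounded_fun) x = a *: (f x) + g x by [].
by rewrite f0 g0 scaler0 addr0.
Qed.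

HB.instance Definition _ := GRing.isSubmodClosed.Build _ _ ae_zero
  ae_zero_submod.

Definition Linf : Type := Quotient.quot ae_zero.

HB.instance Definition _ := GRing.Zmodule.on Linf.
HB.instance Definition _ := EqQuotient.on Linf.

Definition Linf_scale (a : R[i]) : Linf -> Linf := lift_op1 Linf ( *:%R a).

Lemma pi_scale (a : R[i]) : {morph \pi_Linf : f / a *: f >-> Linf_scale a f}.
Proof.
move=> f; unlock Linf_scale; apply/eqP; rewrite -Quotient.idealrBE -scalerBr.
by rewrite rpredZ// Quotient.idealrBE reprK.
Qed.

Lemma Linf_scaleA a b v : Linf_scale a (Linf_scale b v) = Linf_scale (a * b) v.
Proof. by elim/quotW: v => v; rewrite -!pi_scale scalerA. Qed.

Lemma Linf_scale1 : left_id 1 Linf_scale.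
Proof. by elim/quotW => v; rewrite -!pi_scale scale1r. Qed.

Lemma pi_Linf_add (u v : ess_bounded_fun) :
  \pi_Linf (u + v) = \pi_Linf u + \pi_Linf v.
Proof. exact: Quotient.pi_add. Qed.

Lemma Linf_scaleDr : right_distributive Linf_scale +%R.
Proof.
move=> a; elim/quotW => u; elim/quotW => v.
by rewrite -pi_Linf_add -!pi_scale -pi_Linf_add scalerDr.
Qed.

Lemma Linf_scaleDl v : {morph Linf_scale^~ v : a b / a + b}.
Proof.
move=> a b; elim/quotW: v => v.
by rewrite -!pi_scale -pi_Linf_add scalerDl.
Qed.

HB.instance Definition _ := GRing.Zmodule_isLmodule.Build R[i] Linf
  Linf_scaleA Linf_scale1 Linf_scaleDr Linf_scaleDl.

(* a representative of the class f *)
Definition Linf_fun (f : Linf) : R -> R[i] := repr f.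

Definition Linf_norm (f : Linf) : R := fine (ess_norm (Linf_fun f)).

End Linfty.
Arguments Linf R : clear implicits.
Coercion Linf_fun : Linf >-> Funclass.

Section Schwartz.
Context {R : realType}.
Implicit Types g : R -> R[i].

Definition is_schwartz g : Prop :=
  (forall n x, Cderivable (iter n Cderive g) x) /\
  (forall m n, exists M : R, forall x,
     `|x| ^+ m * normc (iter n Cderive g x) <= M).

Definition schwartz_pred : {pred R -> R[i]} := [pred g | `[< is_schwartz g >]].

Lemma iter_Cderive_lin (a : R[i]) f g n :
  is_schwartz f -> is_schwartz g ->
  iter n Cderive (a *: f + g) = a *: iter n Cderive f + iter n Cderive g.
Proof.
move=> [df _] [dg _]; elim: n => //= n ->.
by rewrite Cderive_lin.
Qed.

Lemma is_schwartz0 : is_schwartz 0.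
Proof.
have D0 n : iter n Cderive 0 = 0 :> (R -> R[i]).
  elim: n => //= n ->; apply/funext => x.
  by rewrite /Cderive !derive1E !derive_cst.
split=> [n x|m n]; rewrite D0.
  by split; exact: derivable_cst.
by exists 0 => x; rewrite normc0 mulr0.
Qed.

Lemma schwartz_submod : submod_closed schwartz_pred.
Proof.
split; first by apply/asboolP; exact: is_schwartz0.
move=> a f g /asboolP sf /asboolP sg; apply/asboolP; split.
  move=> n x; rewrite iter_Cderive_lin//.
  by apply: Cderivable_lin; [exact: sf.1|exact: sg.1].
move=> m n; have [M fM] := sf.2 m n; have [N gN] := sg.2 m n.
exists (normc a * M + N) => x; rewrite iter_Cderive_lin// !fctE.
apply: (@le_trans _ _ (`|x| ^+ m * (normc a * normc (iter n Cderive f x)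
                        + normc (iter n Cderive g x)))).
  by rewrite ler_wpM2l ?exprn_ge0// (le_trans (le_normcD _ _))// normcM.
rewrite mulrDr lerD// mulrCA ler_wpM2l//.
by case: (a) => ? ?; exact: sqrtr_ge0.
Qed.

HB.instance Definition _ := GRing.isSubmodClosed.Build _ _ schwartz_pred
  schwartz_submod.

Record schwartz := Schwartz {
  schwartz_val :> R -> R[i] ;
  schwartz_valP : schwartz_val \in schwartz_pred }.

HB.instance Definition _ := [isSub for schwartz_val].
HB.instance Definition _ := [Choice of schwartz by <:].
HB.instance Definition _ := [SubChoice_isSubLmodule of schwartz by <:].

Lemma Cderive_schwartz (phi : schwartz) : Cderive phi \in schwartz_pred.
Proof.
have /asboolP[d b] := schwartz_valP phi; apply/asboolP; split=> [n x|m n].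
  by rewrite -iterSr; exact: d.
by have [M bM] := b m n.+1; exists M => x; rewrite -iterSr.
Qed.

Definition schwartz_derive (phi : schwartz) : schwartz :=
  Schwartz (Cderive_schwartz phi).

(* the defining seminorms sup_x |x|^m |phi^(n)(x)| *)
Definition schwartz_seminorm (m n : nat) (phi : schwartz) : R :=
  sup [set `|x| ^+ m * normc (iter n Cderive phi x) | x in [set: R]].

Definition schwartz_cvg (u : nat -> schwartz) (phi : schwartz) : Prop :=
  forall m n, schwartz_seminorm m n (u k - phi) @[k --> \oo] --> (0 : R).

(* hat phi (t) = int exp(-ist) phi(s) ds *)
Definition schwartz_fourier (phi : schwartz) (t : R) : R[i] :=
  Cintegral [set: R] (fun s => cis (- (s * t)) * phi s).

End Schwartz.
Arguments schwartz R : clear implicits.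

Section Distributions.
Context {R : realType}.
Implicit Types (T : schwartz R -> R[i]) (g : R -> R[i]).

(* Sequential continuity is continuity here, since the topology of the
   Schwartz space is metrizable. *)
Definition is_tempered T : Prop :=
  (forall (a : R[i]) phi psi, T (a *: phi + psi) = a * T phi + T psi) /\
  (forall (u : nat -> schwartz R) phi, schwartz_cvg u phi ->
     normc (T (u k) - T phi) @[k --> \oo] --> (0 : R)).

Definition pairing g (h : R -> R[i]) : R[i] :=
  Cintegral [set: R] (fun t => g t * h t).

Definition regular_dist g : schwartz R -> R[i] := fun phi => pairing g phi.

Definition dist_derive2 T : schwartz R -> R[i] :=
  fun phi => T (schwartz_derive (schwartz_derive phi)).

End Distributions.

Section FourierTransform.
Context {R : realType}.
Implicit Types f : Linf R.

Definition hat1 f (s : R) : R[i] :=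
  Cintegral `[-1, 1] (fun t => cis (- (s * t)) * f t).

Definition Omega f (s : R) : R[i] :=
  oriented_Cintegral 0 s (fun s2 => oriented_Cintegral 0 s2 (hat1 f)).

Definition Psi f (s : R) : R[i] :=
  Cintegral [set t : R | 1 < `|t|]
    (fun t => cis (- (s * t)) * f t / (t ^+ 2)%:C).

Definition Phi f : R -> R[i] := Omega f - Psi f.

Definition fourier f : schwartz R -> R[i] :=
  dist_derive2 (regular_dist (Omega f)) - dist_derive2 (regular_dist (Psi f)).

Definition A_inf : set (schwartz R -> R[i]) := [set fourier f | f in [set: Linf R]].

Definition B_inf : set (R -> R[i]) := [set Phi f | f in [set: Linf R]].

(* The norm of an element of A_inf (resp. B_inf) is the norm of a chosen
   preimage under fourier (resp. Phi); independence of the choice, that is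
   A_norm (fourier f) = Linf_norm f, needs the injectivity of fourier. *)
Definition A_norm (T : schwartz R -> R[i]) : R :=
  Linf_norm (xget 0 [set f | fourier f = T]).

Definition B_norm (g : R -> R[i]) : R :=
  Linf_norm (xget 0 [set f | Phi f = g]).

End FourierTransform.

(* A_norm and B_norm are norms only because fourier and Phi are injective, and
   so cannot be bundled in a normedModType beforehand:
   a normed space is given here as a subset V of a complex vector space with a
   candidate norm N, whose values outside V are irrelevant. *)
Section NormedSpaces.
Context {R : realType}.

Definition normed_space (E : lmodType R[i]) (V : set E) (N : E -> R) : Prop :=
  [/\ V 0,
      forall (a : R[i]) x y, V x -> V y -> V (a *: x + y),
      forall x, V x -> N x = 0 -> x = 0,
      forall (a : R[i]) x, V x -> N (a *: x) = normc a * N x &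
      forall x y, V x -> V y -> N (x + y) <= N x + N y].

Definition cauchy_sequence (E : lmodType R[i]) (N : E -> R) (u : nat -> E) : Prop :=
  forall e : R, 0 < e ->
    exists n0 : nat, forall m n, (n0 <= m)%N -> (n0 <= n)%N -> N (u m - u n) < e.

Definition banach_space (E : lmodType R[i]) (V : set E) (N : E -> R) : Prop :=
  normed_space V N /\
  (forall u : nat -> E, (forall n, V (u n)) -> cauchy_sequence N u ->
     exists2 l, V l & N (u n - l) @[n --> \oo] --> (0 : R)).

Definition isometric_isomorphism (E F : lmodType R[i])
    (V : set E) (N : E -> R) (W : set F) (M : F -> R) (T : E -> F) : Prop :=
  [/\ forall (a : R[i]) x y, V x -> V y -> T (a *: x + y) = a *: T x + T y,
      set_bij V W T &
      forall x, V x -> M (T x) = N x].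

Definition isometrically_isomorphic (E F : lmodType R[i])
    (V : set E) (N : E -> R) (W : set F) (M : F -> R) : Prop :=
  exists T : E -> F, isometric_isomorphism V N W M T.

End NormedSpaces.

(* Main.v *)
(* Twice integrating by parts moves the two derivatives of Omega_f onto hat f_1,
   and turns those of the test function against Psi_f into the factor -t^2, which
   cancels the weight 1/t^2; what remains on both sides is the multiplication
   formula int phi (hat g) = int g (hat phi) for integrable g, i.e. Fubini.

   The norms are well defined because f is determined by hat f: testing on the
   Schwartz functions e^(ibs) e^(-as^2), whose transforms are again Gaussians (the
   transform satisfies y' = -t y/(2a)), gives int f(t) e^(-c(t-b)^2) dt = 0 for all
   c > 0 and b. Taking c = n^2, substituting t = b + u/n, integrating in b over
   [x, y] and letting n tend to infinity yields int_x^y f = 0, hence f = 0 a.e.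

   Finally <hat f, phi> = int Phi_f phi'' with Phi_f of quadratic growth, which
   gives both temperedness and the injectivity of f |-> Phi_f; completeness of
   the two image spaces is transported from L^oo. *)
Require Import Defs.
From mathcomp Require Import all_boot all_order all_algebra.
From mathcomp Require Import generic_quotient ring_quotient complex.
From mathcomp Require Import all_classical all_reals all_analysis.
From mathcomp Require Import measurable_realfun ess_sup_inf.
From mathcomp Require Import ring lra.

Set Implicit Arguments.
Unset Strict Implicit.
Unset Printing Implicit Defensive.
Import Order.TTheory GRing.Theory Num.Theory.
Import numFieldNormedType.Exports.
Import Normc.
Local Open Scope classical_set_scope.
Local Open Scope ring_scope.
Local Open Scope complex_scope.

(** * Integration on the real line *)

Section real_integration.
Context {R : realType}.
Local Notation mu := (@lebesgue_measure R).
Local Notation intble f := (mu.-integrable [set: R] (EFin \o f)).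
Implicit Types f g h : R -> R.

(** Gaussians serve as test functions because their transforms can be computed outright and form an
    approximate identity, so Fourier inversion is avoided. The delicate point is the limit in n: f
    is only bounded and measurable, so f(b + u/n) need not tend to f(b) at a given b. Integrating in
    b first replaces f by its integral over the moving window [x + v, y + v], which is Lipschitz in
    v, so the limit exists for every u. Lebesgue differentiation enters only afterwards, on a
    primitive that vanishes identically.

    The unit of all estimates is 1 + x^2: growth C(1 + x^2) against Schwartz decay N/(1 + x^2)^2
    leaves 1/(1 + x^2), which is integrable and also kills boundary terms.

    Both hat f_1 and Psi_f are transforms of integrable functions w f, for two weights with low +
    t^2 high = 1. As hat f_1 is continuous, Omega_f is twice differentiable classically, and
    integration by parts is the ordinary one.

    An element of L^oo is a class whose chosen representative obeys its norm bound only almost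
    everywhere; pointwise bounds are obtained by passing to a truncated version. *)

Lemma intble_dom f g : measurable_fun setT f -> intble g ->
  (forall x, `|f x| <= g x) -> intble f.
Proof.
move=> mf ig fg; apply: le_integrable ig => //; first exact/measurable_EFinP.
by move=> x _ /=; rewrite lee_fin (le_trans (fg x))// ler_norm.
Qed.

Lemma intble_meas f : intble f -> measurable_fun setT f.
Proof. by move=> /integrableP[/measurable_EFinP]. Qed.

Lemma intbleD f g : intble f -> intble g -> intble (fun x => f x + g x).
Proof. by move=> fi gi; exact: (integrableD measurableT fi gi). Qed.

Lemma intbleB f g : intble f -> intble g -> intble (fun x => f x - g x).
Proof. by move=> fi gi; exact: (integrableB measurableT fi gi). Qed.

Lemma intbleZ a f : intble f -> intble (fun x => a * f x).
Proof. by move=> fi; exact: (integrableZl measurableT _ fi). Qed.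

Lemma intbleMb f g M : intble f -> measurable_fun setT g ->
  (forall x, `|g x| <= M) -> intble (fun x => f x * g x).
Proof.
move=> fi mg gM; apply: (@intble_dom _ (fun x => M * `|f x|)).
- by apply: measurable_funM => //; exact: intble_meas.
- by apply: intbleZ; exact: integrable_norm.
- by move=> x; rewrite normrM mulrC ler_wpM2r.
Qed.

(** Evenness reduces this to the arctangent integral on the half-line. It is the standard majorant:
    most decay estimates below are brought to the form [C / (1 + x^2)]. *)
Lemma intble_oneDsqrV : intble (fun x => (1 + x ^+ 2)^-1).
Proof.
have m : measurable_fun [set: R] (fun x : R => (1 + x ^+ 2)^-1).
  by apply: continuous_measurable_fun => x; exact: continuous_oneDsqrV.
have p (x : R) : 0 <= (1 + x ^+ 2)^-1 by rewrite invr_ge0 addr_ge0// sqr_ge0.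
apply/integrableP; split; first exact/measurable_EFinP.
under eq_integral do rewrite /= ger0_norm//.
rewrite (@ge0_symfun_integralT _ (fun x => (1 + x ^+ 2)^-1))//.
- rewrite (_ : [set x | _] = `[0, +oo[%classic); last first.
    by apply/seteqP; split => x/=; rewrite in_itv/= andbT.
  by rewrite integral0y_oneDsqr -EFinM ltry.
- by move=> x; exact: continuous_oneDsqrV.
- by move=> x /=; rewrite sqrrN.
Qed.

Lemma intble_indic (a b : R) : intble (\1_(`[a, b]) : R -> R).
Proof. exact: integrable_indic_itv. Qed.

(** The product bound gives integrability on the plane by Tonelli, and it makes every section
    integrable, not just almost every one. The inner integrals are therefore finite everywhere and
    real-valued integrals may be iterated. *)
Lemma Fubini_dominated (h : R * R -> R) (a b : R -> R) :
  measurable_fun setT h -> intble a -> intble b ->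
  (forall x y, `|h (x, y)| <= a x * b y) ->
  \int[mu]_x \int[mu]_y h (x, y) = \int[mu]_y \int[mu]_x h (x, y) /\
  intble (fun x => \int[mu]_y h (x, y)).
Proof.
move=> mh ia ib hab.
have mab : measurable_fun [set: R * R] (fun p => a p.1 * b p.2).
  apply: measurable_funM; apply: measurableT_comp => //; exact: intble_meas.
have iab : ((mu \x mu)%E).-integrable setT (EFin \o (fun p => a p.1 * b p.2)).
  apply/integrable12ltyP; first exact/measurable_EFinP.
  have /integrableP[ma fa] := ia; have /integrableP[mb fb] := ib.
  have Eb x : (\int[mu]_y `|(a x * b y)%R%:E| =
      `|a x|%:E * \int[mu]_y `|(EFin \o b) y|)%E.
    rewrite -ge0_integralZl//; last exact: measurableT_comp.
    by apply: eq_integral => y _ /=; rewrite normrM EFinM.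
  under eq_integral do rewrite Eb.
  rewrite ge0_integralZr//; last 2 first.
  - by apply: (measurableT_comp (f := abse) _ ma).
  - exact: integral_ge0.
  apply: lte_mul_pinfty; [exact: integral_ge0| |exact: fb].
  by rewrite ge0_fin_numE; [exact: fa|exact: integral_ge0].
have ih : ((mu \x mu)%E).-integrable setT (EFin \o h).
  apply: le_integrable iab => //; first exact/measurable_EFinP.
  by move=> [x y] _ /=; rewrite lee_fin (le_trans (hab x y))// ler_norm.
have mhx x : measurable_fun setT (fun y => h (x, y)).
  by apply: measurableT_comp => //; exact: pair1_measurable.
have mhy y : measurable_fun setT (fun x => h (x, y)).
  by apply: measurableT_comp => //; exact: pair2_measurable.
have fin1 x : (\int[mu]_y (h (x, y))%:E = (\int[mu]_y h (x, y))%:E)%E.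
  rewrite fineK//; apply: integrable_fin_num => //.
  by apply: (intble_dom (mhx x) (intbleZ (a x) ib)) => y.
have fin2 y : (\int[mu]_x (h (x, y))%:E = (\int[mu]_x h (x, y))%:E)%E.
  rewrite fineK//; apply: integrable_fin_num => //.
  by apply: (intble_dom (mhy y) (intbleZ (b y) ia)) => x; rewrite mulrC.
split.
  have := Fubini ih; rewrite /Rintegral => H; congr fine.
  transitivity (\int[mu]_x \int[mu]_y (h (x, y))%:E)%E.
    by apply: eq_integral => x _; exact/esym/fin1.
  by rewrite [LHS]H; apply: eq_integral => y _; exact: fin2.
have := integrable_fubini_F ih.
by apply: eq_integrable => // x _; exact: fin1.
Qed.

(** The push-forward of Lebesgue measure under [x |-> b + r x], scaled by [r], agrees with Lebesgue
    measure on half-open intervals, hence on all measurable sets. *)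
Lemma integral_affine_ge0 (f : R -> \bar R) (b r : R) : 0 < r ->
  measurable_fun setT f -> (forall x, 0 <= f x)%E ->
  (\int[mu]_x f x = r%:E * \int[mu]_x f (b + r * x)%R)%E.
Proof.
move=> r0 mf f0.
pose phi (x : measurableTypeR R) : measurableTypeR R := b + r * x.
have mphi : measurable_fun [set: measurableTypeR R] phi.
  by apply: measurable_funD => //; apply: measurable_funM.
pose P : {measure set (measurableTypeR R) -> \bar R} :=
  measure_function_pushforward__canonical__measure_function_Measure mu mphi.
pose r' := NngNum (ltW r0).
have <- : (\int[P]_x f x = \int[mu]_x f (b + r * x)%R)%E.
  by rewrite [LHS](ge0_integral_pushforward mphi).
rewrite -[r%:E]/(r'%:num%:E) -(ge0_integral_mscale P measurableT r')//.
apply: eq_measure_integral => A mA _.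
apply: (@lebesgue_measure_unique R (mscale r' P)) => // X /ocitvP[->|[[x y] xy ->]].
  by rewrite !measure0.
rewrite /= /mscale /= /pushforward.
rewrite (_ : phi @^-1` _ = `](x - b) / r, (y - b) / r]%classic); last first.
  apply/seteqP; split => z /=; rewrite !in_itv/= /phi.
    by rewrite ltr_pdivrMr// ler_pdivlMr// ltrBlDl lerBrDl mulrC.
  by rewrite ltr_pdivrMr// ler_pdivlMr// ltrBlDl lerBrDl mulrC.
rewrite !lebesgue_measure_itv/= !lte_fin.
rewrite ltr_pM2r ?invr_gt0// ltrD2r.
by case: ifPn => _; rewrite ?mule0// -EFinM; congr EFin; field; rewrite gt_eqF.
Qed.

Lemma measurable_affine (b r : R) : measurable_fun [set: R] (fun u : R => b + r * u).
Proof. by apply: measurable_funD => //; exact: measurable_funM. Qed.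

Lemma intble_affine f (b r : R) : 0 < r -> intble f -> intble (fun x => f (b + r * x)).
Proof.
move=> r0 /integrableP[mf ff].
have maf : measurable_fun [set: R] (fun x => b + r * x).
  by apply: measurable_funD => //; exact: measurable_funM.
apply/integrableP; split; first exact: (measurableT_comp mf maf).
move: ff; rewrite (integral_affine_ge0 b r0)//; last exact: measurableT_comp.
have : (0 <= \int[mu]_x `|(EFin \o f) (b + r * x)%R|)%E by exact: integral_ge0.
rewrite /comp; case: (integral _ _ _) => [x _ _|_|//]; first by rewrite ltry.
by rewrite gt0_muley ?lte_fin// ltxx.
Qed.

Lemma Rintegral_affine f (b r : R) : 0 < r -> intble f ->
  \int[mu]_x f x = r * \int[mu]_x f (b + r * x).
Proof.
move=> r0 fi; have fi' := intble_affine b r0 fi.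
have mf : measurable_fun setT (EFin \o f) by case/integrableP: fi.
pose A := (\int[mu]_x (EFin \o (fun x => f (b + r * x)%R))^\+ x)%E.
pose B := (\int[mu]_x (EFin \o (fun x => f (b + r * x)%R))^\- x)%E.
rewrite /Rintegral integralE [in RHS]integralE.
rewrite (integral_affine_ge0 b r0 (measurable_funepos mf))//.
rewrite (integral_affine_ge0 b r0 (measurable_funeneg mf))//.
rewrite -[X in _ * fine X]/(A - B)%E.
have <- : A = (\int[mu]_x (EFin \o f)^\+ (b + r * x)%R)%E.
  by apply: eq_integral => x _; rewrite !funeposE.
have <- : B = (\int[mu]_x (EFin \o f)^\- (b + r * x)%R)%E.
  by apply: eq_integral => x _; rewrite !funenegE.
have finA : (A \is a fin_num)%E by exact: integrable_pos_fin_num.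
have finB : (B \is a fin_num)%E by exact: integrable_neg_fin_num.
by rewrite -(fineK finA) -(fineK finB) /= mulrBr.
Qed.

Lemma Rintegral_ae_eq f g D : measurable D ->
  measurable_fun D f -> measurable_fun D g ->
  (\forall x \ae mu, D x -> f x = g x) ->
  \int[mu]_(x in D) f x = \int[mu]_(x in D) g x.
Proof.
move=> mD mf mg fg; congr fine; apply: ae_eq_integral => //;
  try exact/measurable_EFinP.
by move: fg; apply: filterS => x fg Dx /=; rewrite fg.
Qed.

Lemma intble_ae (u v : R -> R) : measurable_fun setT u -> intble v ->
  (\forall x \ae mu, u x = v x) -> intble u.
Proof.
move=> mu_ /[dup] /intble_meas mv /integrableP[_ iv] uv.
apply/integrableP; split; first exact/measurable_EFinP.
suff -> : (\int[mu]_x `|(EFin \o u) x| = \int[mu]_x `|(EFin \o v) x|)%E by [].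
apply: ae_eq_integral => //.
- by apply: measurableT_comp => //; exact/measurable_EFinP.
- by apply: measurableT_comp => //; exact/measurable_EFinP.
- by apply: filterS uv => x /= ->.
Qed.

Lemma Rdominated_cvg (u : nat -> R -> R) f g :
  (forall n, measurable_fun setT (u n)) -> intble g ->
  (forall n x, `|u n x| <= g x) ->
  (forall x, u n x @[n --> \oo] --> f x) ->
  \int[mu]_x u n x @[n --> \oo] --> \int[mu]_x f x.
Proof.
move=> mu_ gi ug uf.
have mf : measurable_fun setT f.
  apply: (@measurable_fun_cvg _ _ _ setT u f) => //.
have fi : intble f.
  apply: (intble_dom mf gi) => x.
  have nc : `|u n x| @[n --> \oo] --> `|f x| by apply: cvg_norm; exact: uf.
  rewrite -(cvg_lim _ nc)//; apply: limr_le; first by apply/cvg_ex; exists `|f x|.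
  exact: nearW.
apply: fine_cvg.
rewrite fineK; last exact: integrable_fin_num.
apply: (@dominated_cvg _ _ _ mu setT measurableT (fun n x => (u n x)%:E)
  (EFin \o f) (EFin \o g)) => //.
- by move=> n; apply/measurable_EFinP; exact: mu_.
- by move=> x _; apply: cvg_EFin; [exact: nearW|exact: uf].
- by move=> n x _; rewrite lee_fin.
Qed.

Lemma derivable_continuous f : (forall x : R, derivable f x 1) -> continuous f.
Proof. by move=> df x; exact/differentiable_continuous/derivable1_diffP/df. Qed.

(** The integral over growing intervals is a difference of boundary values of [G], which tends to 0,
    and by dominated convergence it also tends to the full integral. All integrations by parts below
    apply this to the derivative of a product. *)
Lemma integral_derive_eq0 (G g : R -> R) C :
  (forall x : R, is_derive x 1 G (g x)) -> continuous g -> intble g ->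
  (forall x, `|G x| <= C / (1 + x ^+ 2)) ->
  \int[mu]_x g x = 0.
Proof.
move=> dG cg gi GC.
have cG : continuous G by apply: derivable_continuous => x; have [] := dG x.
(* [n.+1] keeps the interval nondegenerate, as the fundamental theorem of calculus requires. *)
pose u n x : R := (g \_ `[- n.+1%:R, n.+1%:R]) x.
have Iu n : \int[mu]_x u n x = G n.+1%:R - G (- n.+1%:R).
  rewrite -Rintegral_mkcond /Rintegral (@continuous_FTC2 _ _ G)//.
  - by rewrite gtrN.
  - by apply: continuous_subspaceT.
  - split; first by move=> x _; have [] := dG x.
    + exact/cvg_at_right_filter/cG.
    + exact/cvg_at_left_filter/cG.
  - by move=> x _; rewrite derive1E; have [_ ->] := dG x.
have H1 : \int[mu]_x u n x @[n --> \oo] --> \int[mu]_x g x.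
  apply: (@Rdominated_cvg _ _ (fun x => `|g x|)).
  - move=> n; apply/measurable_restrict => //.
    by apply: measurable_funTS; exact: intble_meas.
  - exact: integrable_norm.
  - by move=> n x; rewrite /u patchE; case: ifPn => //; rewrite normr0.
  - move=> x; apply: (@cvg_near_cst _ _ (g x)).
    near=> n; rewrite /u patchE mem_set//= in_itv/=.
    rewrite -ler_norml (@le_trans _ _ n%:R)//; last by rewrite ler_nat.
    by near: n; exact: nbhs_infty_ger.
have H2 : \int[mu]_x u n x @[n --> \oo] --> (0 : R).
  apply: (@squeeze_cvgr _ _ _ _ (fun n => - (C * 2 * n.+1%:R^-1))
    (fun n => C * 2 * n.+1%:R^-1)).
  - near=> n; rewrite Iu -ler_norml.
    rewrite (le_trans (ler_normB _ _))// (le_trans (lerD (GC _) (GC _)))//.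
    have C0 : 0 <= C.
      by have := GC 0; rewrite expr0n/= addr0 divr1; exact: le_trans.
    rewrite sqrrN -mulr2n -mulrnAl -(mulr_natr C 2) ler_wpM2l ?mulr_ge0//.
    rewrite lef_pV2 ?posrE ?addr_gt0 ?exprn_gt0//.
    by rewrite (@le_trans _ _ (n.+1%:R ^+ 2))// ?lerDr// expr2 ler_peMr// ler1n.
  - rewrite -oppr0; apply: cvgN; rewrite -(mulr0 (C * 2)); apply: cvgMr.
    exact: cvg_harmonic.
  - rewrite -(mulr0 (C * 2)); apply: cvgMr; exact: cvg_harmonic.
exact: (cvg_unique _ H1 H2).
Unshelve. all: end_near. Qed.

End real_integration.

(** * Gaussians *)

Section derivative_rules.
Context {R : realType}.
Implicit Types (f g : R -> R) (x a b c : R).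

Lemma ider_ext f g x a b :
  is_derive x 1 f a -> f =1 g -> a = b -> is_derive x 1 g b.
Proof. by move=> df /funext <- <-. Qed.

Lemma iderD f g x a b : is_derive x 1 f a -> is_derive x 1 g b ->
  is_derive x 1 (fun s => f s + g s) (a + b).
Proof. by move=> df dg; exact: is_deriveD. Qed.

Lemma iderB f g x a b : is_derive x 1 f a -> is_derive x 1 g b ->
  is_derive x 1 (fun s => f s - g s) (a - b).
Proof. by move=> df dg; exact: is_deriveB. Qed.

Lemma iderM f g x a b : is_derive x 1 f a -> is_derive x 1 g b ->
  is_derive x 1 (fun s => f s * g s) (a * g x + f x * b).
Proof.
move=> df dg; apply: (is_derive_eq (is_deriveM df dg)).
by rewrite /GRing.scale/= addrC mulrC.
Qed.

Lemma iderZ c f x a : is_derive x 1 f a ->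
  is_derive x 1 (fun s => c * f s) (c * a).
Proof. by move=> df; exact: (is_deriveZ c df). Qed.

Lemma ider_cos b x : is_derive x 1 (fun s => cos (b * s)) (- (b * sin (b * x))).
Proof.
have d : is_derive x 1 (fun s => b * s) (b * 1) by apply: iderZ.
have := is_derive1_comp (is_derive_cos (b * x)) d.
by move/ider_ext; apply => //; ring.
Qed.

Lemma ider_sin b x : is_derive x 1 (fun s => sin (b * s)) (b * cos (b * x)).
Proof.
have d : is_derive x 1 (fun s => b * s) (b * 1) by apply: iderZ.
have := is_derive1_comp (is_derive_sin (b * x)) d.
by move/ider_ext; apply => //; ring.
Qed.

Lemma ider_gauss c x : is_derive x 1 (fun s => expR (- (c * s ^+ 2)))
  (- (2 * c) * (x * expR (- (c * x ^+ 2)))).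
Proof.
have d : is_derive x 1 (fun s => (- c) * (s * s)) ((- c) * (1 * x + x * 1)).
  by apply: iderZ; apply: iderM.
have := is_derive1_comp (is_derive_expR _) d.
move/ider_ext; apply => [y|] /=; first by rewrite mulNr expr2.
by rewrite mulNr -expr2; ring.
Qed.

End derivative_rules.

Section gaussian.
Context {R : realType}.
Local Notation mu := (@lebesgue_measure R).
Local Notation intble f := (mu.-integrable [set: R] (EFin \o f)).
Local Notation gauss c x := (expR (- (c * x ^+ 2))).

Definition rapid (h : R -> R) :=
  forall m, exists M : R, forall x, `|x| ^+ m * `|h x| <= M.

(* A class closed under differentiation, which avoids naming the polynomial
   factors of the iterated derivatives. *)
Inductive gauss_span (c b : R) : (R -> R) -> Prop :=
| gs_cos : gauss_span c b (fun s => cos (b * s) * gauss c s)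
| gs_sin : gauss_span c b (fun s => sin (b * s) * gauss c s)
| gs_D f g : gauss_span c b f -> gauss_span c b g ->
    gauss_span c b (fun s => f s + g s)
| gs_Z a f : gauss_span c b f -> gauss_span c b (fun s => a * f s)
| gs_X f : gauss_span c b f -> gauss_span c b (fun s => s * f s).

Lemma gauss_span_derive c b h : gauss_span c b h ->
  exists2 h', gauss_span c b h' & forall x : R, is_derive x 1 h (h' x).
Proof.
elim=> [||f g _ [f' sf df] _ [g' sg dg]|a f _ [f' sf df]|f sf [f' sf' df]].
- exists (fun s => (- b) * (sin (b * s) * gauss c s) +
                   (- (2 * c)) * (s * (cos (b * s) * gauss c s))).
    apply: gs_D; apply: gs_Z; [exact: gs_sin|apply: gs_X; exact: gs_cos].
  move=> x; apply: ider_ext (iderM (ider_cos b x) (ider_gauss c x)) _ _ => //.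
  by ring.
- exists (fun s => b * (cos (b * s) * gauss c s) +
                   (- (2 * c)) * (s * (sin (b * s) * gauss c s))).
    apply: gs_D; apply: gs_Z; [exact: gs_cos|apply: gs_X; exact: gs_sin].
  move=> x; apply: ider_ext (iderM (ider_sin b x) (ider_gauss c x)) _ _ => //.
  by ring.
- by exists (fun s => f' s + g' s) => [|x]; [exact: gs_D|exact: iderD].
- by exists (fun s => a * f' s) => [|x]; [exact: gs_Z|exact: iderZ].
- exists (fun s => f s + s * f' s); first by apply: gs_D => //; exact: gs_X.
  move=> x; apply: ider_ext (iderM (is_derive_id x 1) (df x)) _ _ => //.
  by rewrite mul1r.
Qed.

Lemma gauss_span_continuous c b h : gauss_span c b h -> continuous h.
Proof.
move=> /gauss_span_derive[h' _ dh]; apply: derivable_continuous => x.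
by have [] := dh x.
Qed.

Lemma rapid_gauss c : 0 < c -> rapid (fun x => gauss c x).
Proof.
(* Since [|x|^m <= 1 + (x^2)^(m+1)], the first term contributes at most 1; the second is controlled
   by [(c x^2)^(m+1) / (m+1)! <= exp (c x^2)]. *)
move=> c0 m; exists (1 + m.+1`!%:R / c ^+ m.+1) => x.
rewrite (ger0_norm (expR_ge0 _)).
have x0 : 0 <= x ^+ 2 by exact: sqr_ge0.
have le1 : gauss c x <= 1.
  by rewrite -expR0 ler_expR oppr_le0 mulr_ge0// ltW.
have lem : `|x| ^+ m <= 1 + (x ^+ 2) ^+ m.+1.
  have [x1|x1] := leP `|x| 1.
    by rewrite (le_trans (exprn_ile1 m _ x1))// lerDl exprn_ge0.
  rewrite -(real_normK (num_real x)) -exprM.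
  rewrite (@le_trans _ _ (`|x| ^+ (2 * m.+1)))// ?lerDr//.
  by rewrite ler_weXn2l// ?(ltW x1)// mul2n -addnn addSn ltnW// ltnS leq_addr.
apply: (le_trans (ler_wpM2r (expR_ge0 _) lem)).
rewrite mulrDl mul1r lerD//.
rewrite expRN -ler_pdivlMr ?invr_gt0 ?expR_gt0// invrK.
rewrite mulrAC ler_pdivlMr ?exprn_gt0// -exprMn.
rewrite (mulrC _ (expR _)) -ler_pdivrMr ?ltr0n ?fact_gt0//.
apply: le_trans (expR_ge1Dxn m (mulr_ge0 (ltW c0) x0)).
by rewrite (mulrC c) lerDr.
Qed.

Lemma gauss_span_rapid c b h : 0 < c -> gauss_span c b h -> rapid h.
Proof.
move=> c0; elim=> [||f g _ rf _ rg|a f _ rf|f _ rf] m.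
- have [M HM] := rapid_gauss c0 m; exists M => x.
  rewrite (le_trans _ (HM x))// ler_wpM2l ?exprn_ge0// normrM ler_piMl//.
  by rewrite ler_norml cos_geN1 cos_le1.
- have [M HM] := rapid_gauss c0 m; exists M => x.
  rewrite (le_trans _ (HM x))// ler_wpM2l ?exprn_ge0// normrM ler_piMl//.
  by rewrite ler_norml sin_geN1 sin_le1.
- have [M HM] := rf m; have [N HN] := rg m; exists (M + N) => x.
  rewrite (le_trans _ (lerD (HM x) (HN x)))// -mulrDr.
  by rewrite ler_wpM2l ?exprn_ge0// ler_normD.
- have [M HM] := rf m; exists (`|a| * M) => x.
  by rewrite normrM mulrCA ler_wpM2l.
- have [M HM] := rf m.+1; exists M => x.
  by rewrite normrM mulrA -exprSr.
Qed.

Lemma rapid_le h : rapid h -> exists M, forall x, `|h x| <= M / (1 + x ^+ 2).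
Proof.
move=> rh; have [M HM] := rh 0; have [N HN] := rh 2; exists (M + N) => x.
rewrite ler_pdivlMr ?ltr_wpDr ?sqr_ge0// mulrDr mulr1 lerD//.
  by have := HM x; rewrite expr0 mul1r.
by have := HN x; rewrite real_normK ?num_real// mulrC.
Qed.

Lemma rapid_intble h : measurable_fun setT h -> rapid h -> intble h.
Proof.
move=> mh /rapid_le[M HM].
exact: (intble_dom mh (intbleZ M intble_oneDsqrV)).
Qed.

Lemma gauss_span_intble c b h : 0 < c -> gauss_span c b h -> intble h.
Proof.
move=> c0 sh; apply: rapid_intble (gauss_span_rapid c0 sh).
by apply: continuous_measurable_fun; exact: gauss_span_continuous sh.
Qed.

Lemma gauss_intble c : 0 < c -> intble (fun s => gauss c s).
Proof.
move=> c0; have := gauss_span_intble c0 (gs_cos c 0).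
by apply: eq_integrable => // x _ /=; rewrite mul0r cos0 mul1r.
Qed.

Lemma gauss_span_integral_derive c b h h' : 0 < c -> gauss_span c b h ->
  gauss_span c b h' -> (forall x : R, is_derive x 1 h (h' x)) ->
  \int[mu]_x h' x = 0.
Proof.
move=> c0 sh sh' dh; have [M HM] := rapid_le (gauss_span_rapid c0 sh).
apply: (integral_derive_eq0 dh _ _ HM).
- exact: gauss_span_continuous sh'.
- exact: gauss_span_intble sh'.
Qed.

(** The product of [y] with the integrating factor [exp (k s^2)] has zero derivative. The factor is
    written as a Gaussian with coefficient [- k] so that [ider_gauss] differentiates it. *)
Lemma linear_ode (y : R -> R) (k t : R) :
  (forall t : R, is_derive t 1 y (- (2 * k) * (t * y t))) ->
  y t = y 0 * gauss k t.
Proof.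
move=> dy; pose z s := y s * expR (- (- k * s ^+ 2)).
have /(@is_derive_0_is_cst _ z t 0) : forall s : R, is_derive s 1 z 0.
  move=> s; apply: ider_ext (iderM (dy s) (ider_gauss (- k) s)) _ _ => //.
  by ring.
rewrite /z expr0n/= mulr0 oppr0 expR0 mulr1 => <-.
by rewrite -mulrA -expRD mulNr opprK subrr expR0 mulr1.
Qed.

End gaussian.

(** * Fourier integrals of Gaussians *)

Section gaussian_fourier.
Context {R : realType}.
Local Notation mu := (@lebesgue_measure R).
Local Notation intble f := (mu.-integrable [set: R] (EFin \o f)).
Local Notation gauss c x := (expR (- (c * x ^+ 2))).

Lemma is_derive_integral (F F' : R -> R -> R) (G : R -> R) (t : R) :
  (forall x, intble (F x)) -> (forall x y : R, is_derive x 1 (F ^~ y) (F' x y)) ->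
  (forall y, 0 <= G y) -> intble G -> (forall x y, `|F' x y| <= G y) ->
  is_derive t 1 (fun x => \int[mu]_y F x y) (\int[mu]_y F' t y).
Proof.
move=> iF dF G0 iG FG.
have d1 x y : partial1of2 F x y = F' x y by rewrite partial1of2E; have [_ ->] := dF x y.
have It : `](t - 1), (t + 1)[%classic t.
  by rewrite /= in_itv/= gtrBl ltrDl ltr01.
have dd := @derivable_under_integral _ _ _ mu F setT measurableT t (t - 1) (t + 1)
  It (fun x _ => iF x) (fun x y _ _ => let: DeriveDef d _ := dF x y in d) G G0 iG.
have ed := @differentiation_under_integral _ _ _ mu F setT measurableT t (t - 1) (t + 1)
  It (fun x _ => iF x) (fun x y _ _ => let: DeriveDef d _ := dF x y in d) G G0 iG.
apply: DeriveDef.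
  by apply: dd => x y _ _; rewrite d1.
rewrite -derive1E ed; first by apply: eq_Rintegral => y _; exact: d1.
by move=> x y _ _; rewrite d1.
Qed.

Variable c : R.
Hypothesis c0 : 0 < c.

Let XE_intble : intble (fun s => `|s * gauss c s|).
Proof.
apply: integrable_norm.
have := gauss_span_intble c0 (gs_X (gs_cos c 0)).
by apply: eq_integrable => // x _ /=; rewrite mul0r cos0 mul1r.
Qed.

Let XEle (u s : R) : `|u| <= 1 -> `|s * (u * gauss c s)| <= `|s * gauss c s|.
Proof.
by move=> u1; rewrite mulrCA normrM ler_piMl.
Qed.

(** The [s]-derivative of [sin (t s) exp (-c s^2)] integrates to zero. The left side is, up to sign,
    the [t]-derivative of the cosine transform, so this identity is its differential equation. *)
Lemma gauss_sin_parts (t : R) :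
  \int[mu]_s (s * (sin (t * s) * gauss c s)) =
  t / (2 * c) * \int[mu]_s (cos (t * s) * gauss c s).
Proof.
have i1 := gauss_span_intble c0 (gs_cos c t).
have i2 := gauss_span_intble c0 (gs_X (gs_sin c t)).
have : \int[mu]_s (t * (cos (t * s) * gauss c s) +
                   (- (2 * c)) * (s * (sin (t * s) * gauss c s))) = 0.
  apply: (gauss_span_integral_derive c0 (gs_sin c t)).
    by apply: gs_D; apply: gs_Z; [exact: gs_cos|apply: gs_X; exact: gs_sin].
  move=> x; apply: ider_ext (iderM (ider_sin t x) (ider_gauss c x)) _ _ => //.
  by ring.
rewrite RintegralD//; [|exact: intbleZ|exact: intbleZ].
rewrite !RintegralZl// => /eqP; rewrite mulNr subr_eq0 => /eqP H.
apply: (@mulfI _ (2 * c)); first by rewrite mulf_neq0// gt_eqF.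
by rewrite -H; field; rewrite gt_eqF.
Qed.

Lemma gauss_cos_parts (t : R) :
  \int[mu]_s (s * (cos (t * s) * gauss c s)) =
  - (t / (2 * c)) * \int[mu]_s (sin (t * s) * gauss c s).
Proof.
have i1 := gauss_span_intble c0 (gs_sin c t).
have i2 := gauss_span_intble c0 (gs_X (gs_cos c t)).
have : \int[mu]_s ((- t) * (sin (t * s) * gauss c s) +
                   (- (2 * c)) * (s * (cos (t * s) * gauss c s))) = 0.
  apply: (gauss_span_integral_derive c0 (gs_cos c t)).
    by apply: gs_D; apply: gs_Z; [exact: gs_sin|apply: gs_X; exact: gs_cos].
  move=> x; apply: ider_ext (iderM (ider_cos t x) (ider_gauss c x)) _ _ => //.
  by ring.
rewrite RintegralD//; [|exact: intbleZ|exact: intbleZ].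
rewrite !RintegralZl// => /eqP; rewrite (mulNr (2 * c)) subr_eq0 => /eqP H.
apply: (@mulfI _ (2 * c)); first by rewrite mulf_neq0// gt_eqF.
by rewrite -H; field; rewrite gt_eqF.
Qed.

Lemma gauss_cos_integral (t : R) :
  \int[mu]_s (cos (t * s) * gauss c s) =
  (\int[mu]_s gauss c s) * gauss (4 * c)^-1 t.
Proof.
pose y t := \int[mu]_s (cos (t * s) * gauss c s).
have -> : \int[mu]_s gauss c s = y 0.
  by apply: eq_Rintegral => s _; rewrite mul0r cos0 mul1r.
(* With [k = (4 c)^-1] the coefficient [2 k] is the [1 / (2 c)] produced by [gauss_sin_parts]. *)
apply: (@linear_ode _ y) => {}t.
have d : is_derive t 1 y (\int[mu]_s ((- 1) * (s * (sin (t * s) * gauss c s)))).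
  apply: (@is_derive_integral (fun t s => cos (t * s) * gauss c s)
    (fun t s => (- 1) * (s * (sin (t * s) * gauss c s))) (fun s => `|s * gauss c s|)).
  - by move=> x; exact: gauss_span_intble (gs_cos c x).
  - move=> x s; have d := iderM (ider_cos s x) (is_derive_cst (gauss c s) x 1).
    apply: ider_ext d _ _ => [z|]; first by rewrite (mulrC z).
    by rewrite /cst/= (mulrC x); ring.
  - by [].
  - exact: XE_intble.
  - by move=> x s; rewrite mulN1r normrN XEle// ler_norml sin_geN1 sin_le1.
apply: (is_derive_eq d).
rewrite RintegralZl//; last exact: gauss_span_intble (gs_X (gs_sin c t)).
by rewrite gauss_sin_parts /y; field; rewrite gt_eqF.
Qed.

(** The sine transform solves the same differential equation, with initial value 0. *)
Lemma gauss_sin_integral (t : R) :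
  \int[mu]_s (sin (t * s) * gauss c s) = 0.
Proof.
pose y t := \int[mu]_s (sin (t * s) * gauss c s).
rewrite -/(y t); suff -> : y t = y 0 * gauss (4 * c)^-1 t.
  rewrite /y -[RHS](mul0r (gauss (4 * c)^-1 t)); congr (_ * _).
  rewrite -[RHS](mul0r (\int[mu]_s gauss c s)).
  under eq_Rintegral do rewrite mul0r sin0 mul0r.
  by rewrite /Rintegral integral0 mul0r.
apply: (@linear_ode _ y) => {}t.
have d : is_derive t 1 y (\int[mu]_s (s * (cos (t * s) * gauss c s))).
  apply: (@is_derive_integral (fun t s => sin (t * s) * gauss c s)
    (fun t s => s * (cos (t * s) * gauss c s)) (fun s => `|s * gauss c s|)).
  - by move=> x; exact: gauss_span_intble (gs_sin c x).
  - move=> x s; have d := iderM (ider_sin s x) (is_derive_cst (gauss c s) x 1).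
    apply: ider_ext d _ _ => [z|]; first by rewrite (mulrC z).
    by rewrite /cst/= (mulrC x); ring.
  - by [].
  - exact: XE_intble.
  - by move=> x s; rewrite XEle// ler_norml cos_geN1 cos_le1.
apply: (is_derive_eq d).
by rewrite gauss_cos_parts /y; field; rewrite gt_eqF.
Qed.

(** Rescaling by the square root of [c] reduces to the known value at [c = 1]. Positivity is used to
    cancel this factor in the uniqueness arguments. *)
Lemma gauss_integral_gt0 : 0 < \int[mu]_s gauss c s.
Proof.
have r0 : 0 < Num.sqrt c by rewrite sqrtr_gt0.
have /esym := Rintegral_affine 0 r0 (@integrableT_gauss R).
rewrite {2}/Rintegral integralT_gauss/= => /(canRL (mulKf (lt0r_neq0 r0))) I.
rewrite (_ : \int[mu]_s gauss c s = (Num.sqrt c)^-1 * Num.sqrt pi).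
  by rewrite mulr_gt0 ?invr_gt0 ?sqrtr_gt0 ?pi_gt0.
rewrite -I; apply: eq_Rintegral => s _.
by rewrite /gauss_fun add0r exprMn sqr_sqrtr// ltW.
Qed.

End gaussian_fourier.

(** * Uniqueness from Gaussian averages *)

Section gaussian_uniqueness.
Context {R : realType}.
Local Notation mu := (@lebesgue_measure R).
Local Notation intble f := (mu.-integrable [set: R] (EFin \o f)).
Local Notation gauss c x := (expR (- (c * x ^+ 2))).
Variables (f : R -> R) (M : R).
Hypothesis mf : measurable_fun setT f.
Hypothesis fM : forall x, `|f x| <= M.

(** Truncated to [[-n, n]], [f] is integrable and its primitive is identically zero; by Lebesgue
    differentiation the derivative of that primitive is [f] almost everywhere on the interval.
    Countably many [n] cover the line. *)
Lemma bounded_ae_eq0 : (forall x y : R, x <= y -> \int[mu]_(t in `[x, y]) f t = 0) ->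
  \forall x \ae mu, f x = 0.
Proof.
move=> f0.
suff H : forall n : nat, \forall x \ae mu, `|x| <= n%:R -> f x = 0.
  apply: filterS (ae_foralln H) => x Hx.
  have [n xn] : exists n : nat, `|x| <= n%:R.
    by exists (Num.truncn `|x|).+1; exact/ltW/truncnS_gt.
  exact: Hx xn.
move=> n.
pose h := f \_ `[- n%:R, n%:R].
have hi : intble h.
  have := @intbleMb _ _ f M (intble_indic (- n%:R) n%:R) mf fM.
  apply: eq_integrable => // x _ /=; rewrite /h patchE indicE.
  by case: ifP; rewrite ?mul1r ?mul0r.
have hiy y : mu.-integrable `]-oo, y] (EFin \o h) by exact: integrableS hi.
have hloc : locally_integrable setT h.
  by apply: open_integrable_locally => //; exact: openT.
have := FTC1Ny hiy hloc; apply: filterS => x [_ +] xn.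
rewrite (_ : (fun _ => _) = cst 0); last first.
  apply/funext => z /=; rewrite /h -Rintegral_mkcondr.
  have -> : `]-oo, z] `&` `[- n%:R, n%:R] = `[- n%:R, Num.min z n%:R]%classic :> set R.
    apply/seteqP; split => t /=; rewrite !in_itv/= le_min.
      by move=> [-> /andP[-> ->]].
    by move=> /andP[-> /andP[-> ->]].
  have [|zn] := leP (- n%:R) (Num.min z n%:R); first exact: f0.
  by rewrite set_itv_ge ?Rintegral_set0// -leNgt bnd_simp// ltW.
by rewrite derive1_cst /h patchE mem_set//= in_itv/= -ler_norml.
Qed.

Lemma gauss_orthogonal_eq0 :
  (forall c b : R, 0 < c -> \int[mu]_t (f t * gauss c (t - b)) = 0) ->
  \forall x \ae mu, f x = 0.
Proof.
move=> forth; apply: bounded_ae_eq0 => x y xy.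
have gi := @gauss_intble R.
(* [D v] is the integral of [f] over the window [[x + v, y + v]]: the average in [b] that makes the
   dependence on the shift continuous. *)
pose D (v : R) := \int[mu]_b (\1_(`[x, y]) b * f (b + v)).
have mshift (v : R) : measurable_fun setT (fun b : R => f (b + v)).
  by apply: (measurableT_comp mf); exact: measurable_funD.
have mscale (b : R) (r : R) : measurable_fun setT (fun u : R => f (b + r * u)).
  by apply: (measurableT_comp mf); exact: measurable_affine.
have W0 n (b : R) : \int[mu]_u (f (b + n.+1%:R^-1 * u) * gauss 1 u) = 0.
  have n0 : 0 < n.+1%:R :> R by [].
  have := forth (n.+1%:R ^+ 2) b (exprn_gt0 _ n0).
  have n0' : 0 < n.+1%:R^-1 :> R by rewrite invr_gt0.
  rewrite (Rintegral_affine b n0'); last first.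
    have gi' := intble_affine (- b) ltr01 (gi _ (exprn_gt0 2 n0)).
    have := intbleMb gi' mf fM.
    by apply: eq_integrable => // t _ /=; rewrite mul1r (addrC (- b)) mulrC.
  move=> /eqP; rewrite mulf_eq0 gt_eqF//= => /eqP <-.
  apply: eq_Rintegral => u _; congr (_ * expR (- _)).
  by rewrite addrAC subrr add0r -exprMn [_%:R * _]mulrA divff ?gt_eqF// !mul1r.
have mg : measurable_fun setT (fun u : R => gauss 1 u).
  by apply: intble_meas; exact: gi.
have D0 n : \int[mu]_u (gauss 1 u * D (n.+1%:R^-1 * u)) = 0.
  pose h (p : R * R) := \1_(`[x, y]) p.1 * f (p.1 + n.+1%:R^-1 * p.2) * gauss 1 p.2.
  have mh : measurable_fun setT h.
    apply: measurable_funM; last exact: (measurableT_comp mg).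
    apply: measurable_funM.
      exact: (measurableT_comp (intble_meas (intble_indic x y)) measurable_fst).
    apply: (measurableT_comp mf); apply: measurable_funD; first exact: measurable_fst.
    exact: (measurableT_comp (mulrl_measurable _) measurable_snd).
  have [] := @Fubini_dominated _ h (fun b => M * \1_(`[x, y]) b)
    (fun u => gauss 1 u) mh (intbleZ M (intble_indic x y)) (gi 1 ltr01).
    move=> b u; rewrite /h/= !normrM [`|expR _|]ger0_norm ?expR_ge0//.
    by rewrite ler_wpM2r ?expR_ge0// mulrC [`|\1_ _ _|]ger0_norm// ler_wpM2r.
  rewrite /h/= => H _; rewrite [RHS](_ : 0 = \int[mu]_b (cst 0 b)); last first.
    by rewrite /Rintegral integral0.
  transitivity (\int[mu]_u \int[mu]_b
      (\1_(`[x, y]) b * f (b + n.+1%:R^-1 * u) * gauss 1 u)).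
    apply: eq_Rintegral => u _; rewrite [LHS]mulrC [RHS]RintegralZr; [by []|by []|].
    exact: (intbleMb (intble_indic x y) (mshift _) (fun _ => fM _)).
  rewrite -H; apply: eq_Rintegral => b _.
  under eq_Rintegral do rewrite -mulrA.
  rewrite RintegralZl; [by rewrite W0 mulr0|by []|].
  have := intbleMb (gi 1 ltr01) (mscale b n.+1%:R^-1) (fun u => fM _).
  by apply: eq_integrable; [by []|move=> u _; congr EFin; exact: mulrC].
have M0 : 0 <= M by exact: le_trans (fM 0).
have iE (a b t : R) : \1_(`[a, b]) t = (a <= t <= b)%R%:R :> R.
  by rewrite indicE mem_setE in_itv.
have Iindic (a b : R) : a <= b -> \int[mu]_t \1_(`[a, b]) t = b - a.
  move=> ab; rewrite /Rintegral integral_indic// setIT.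
  rewrite -[RHS]/(fine (b - a)%:E); congr fine.
  apply: (etrans (lebesgue_measure_itv `[a, b])); rewrite /= lte_fin.
  by move: ab; rewrite le_eqVlt => /predU1P[->|->]; rewrite ?ltxx ?subrr// -EFinB.
(* The windows at [v] and [w] differ only inside [[x + v, x + w]] and [[y + v, y + w]], each of
   length [w - v], and [f] is at most [M] there. *)
have Dlip (v w : R) : v <= w -> `|D v - D w| <= 2 * M * (w - v).
  move=> vw.
  have DE (u : R) : D u = \int[mu]_t (\1_(`[x + u, y + u]) t * f t).
    rewrite /D (Rintegral_affine (- u) ltr01) ?mul1r; last first.
      exact: intbleMb (intble_indic x y) (mshift _) (fun _ => fM _).
    apply: eq_Rintegral => t _; rewrite mul1r addrC subrK !iE.
    by rewrite lerBrDr lerBlDr.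
  have ii a b : intble (fun t => \1_(`[a, b]) t * f t).
    exact: intbleMb (intble_indic a b) mf fM.
  rewrite !DE -RintegralB//.
  apply: (le_trans (le_normr_Rintegral _ _)) => //; first exact: intbleB.
  have J : intble (fun t => M * (\1_(`[x + v, x + w]) t + \1_(`[y + v, y + w]) t)).
    by apply: intbleZ; apply: intbleD; exact: intble_indic.
  apply: (le_trans (le_Rintegral _ _ J _)) => //.
  - by apply: integrable_norm; exact: intbleB.
  - move=> t _; rewrite -mulrBl normrM mulrC ler_pM// !iE.
    have [] := boolP (x + v <= t <= y + v); have [] := boolP (x + w <= t <= y + w).
    - by rewrite subrr normr0 -natrD.
    - move=> n1 /andP[h1 h2]; rewrite subr0 normr1.
      suff -> : x + v <= t <= x + w by rewrite -natrD ler1n.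
      rewrite h1/= leNgt; apply: contra n1 => h3; rewrite (ltW h3)/=.
      by rewrite (le_trans h2)// lerD2l.
    - move=> /andP[h1 h2] n1; rewrite sub0r normrN normr1.
      suff -> : y + v <= t <= y + w by rewrite -natrD ler1n addn1.
      rewrite h2 andbT leNgt; apply: contra n1 => h3; rewrite (ltW h3) andbT.
      by rewrite (le_trans _ h1)// lerD2l.
    - by rewrite subrr normr0 -natrD.
  - rewrite RintegralZl//; last by apply: intbleD; exact: intble_indic.
    rewrite RintegralD; [|by []|exact: intble_indic|exact: intble_indic].
    rewrite !Iindic ?lerD2l//.
    rewrite [leRHS](_ : _ = M * (x + w - (x + v) + (y + w - (y + v))))//; ring.
have Dlip' (v w : R) : `|D v - D w| <= 2 * M * `|w - v|.
  have [vw|/ltW wv] := leP v w; first by rewrite [`|w - v|]ger0_norm ?subr_ge0// Dlip.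
  by rewrite distrC [`|w - v|]distrC [`|v - w|]ger0_norm ?subr_ge0// Dlip.
have cD : continuous D.
  (* The added 1 gives a positive divisor even when [M = 0]. *)
  have M1 : 0 < 2 * M + 1 by rewrite ltr_wpDl// mulr_ge0.
  move=> v; apply/cvgrPdist_le => e e0; near=> w.
  rewrite (le_trans (Dlip' _ _))// (@le_trans _ _ ((2 * M + 1) * `|w - v|))//.
    by rewrite ler_wpM2r// lerDl.
  rewrite mulrC -ler_pdivlMr// distrC.
  near: w; apply: cvgr_dist_le; [exact: cvg_id|by rewrite divr_gt0].
have DM v : `|D v| <= M * (y - x).
  have i1 := intbleMb (intble_indic x y) (mshift v) (fun _ => fM _).
  apply: (le_trans (le_normr_Rintegral measurableT i1)).
  have i2 := intbleZ M (intble_indic x y).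
  apply: (@le_trans _ _ (\int[mu]_b (M * \1_(`[x, y]) b))).
    apply: le_Rintegral; [by []|exact: integrable_norm|exact: i2|].
    by move=> t _; rewrite normrM mulrC [`|\1_ _ _|]ger0_norm// ler_wpM2r.
  by rewrite RintegralZl ?Iindic//; exact: intble_indic.
(* By continuity of [D] at 0 the integrals in [D0], all zero, converge to [D 0] times the Gaussian
   integral; since the latter is positive, [D 0 = 0]. *)
have H1 : \int[mu]_u (gauss 1 u * D (n.+1%:R^-1 * u)) @[n --> \oo]
    --> \int[mu]_u (gauss 1 u * D 0).
  apply: (@Rdominated_cvg _ _ _ (fun u => M * (y - x) * gauss 1 u)).
  - move=> n; apply: measurable_funM; first exact: mg.
    exact: (measurableT_comp (continuous_measurable_fun cD) (mulrl_measurable _)).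
  - by apply: intbleZ; exact: gi.
  - by move=> n u; rewrite normrM [`|expR _|]ger0_norm ?expR_ge0// mulrC ler_wpM2r ?expR_ge0.
  - move=> u; apply: cvgMr.
    have v0 : n.+1%:R^-1 * u @[n --> \oo] --> (0 : R).
      by rewrite -[X in _ --> X](mul0r u); apply: cvgMl; exact: cvg_harmonic.
    exact: (cvg_comp _ D v0 (cD 0)).
have {}H1 : \int[mu]_u (gauss 1 u * D 0) = 0.
  apply: (cvg_unique _ H1) => //; rewrite (_ : (fun _ => _) = cst 0); first exact: cvg_cst.
  by apply/funext => n; exact: D0.
move: H1; rewrite RintegralZr//; last exact: gi.
move=> /eqP; rewrite mulf_eq0 gt_eqF ?gauss_integral_gt0//= => /eqP D00.
transitivity (D 0) => //; rewrite /D [LHS]Rintegral_mkcond; apply: eq_Rintegral => t _.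
by rewrite patchE addr0 indicE; case: ifP; rewrite ?mul1r ?mul0r.
Unshelve. all: end_near. Qed.

End gaussian_uniqueness.

(** * Complex integrals and the Fourier transform of integrable functions *)

Section complex_integration.
Context {R : realType}.
Local Notation mu := (@lebesgue_measure R).
Local Notation intble f := (mu.-integrable [set: R] (EFin \o f)).
Local Notation Re := complex.Re.
Local Notation Im := complex.Im.

Lemma ReM (x y : R[i]) : Re (x * y) = Re x * Re y - Im x * Im y.
Proof. by case: x => ? ?; case: y. Qed.

Lemma ImM (x y : R[i]) : Im (x * y) = Re x * Im y + Im x * Re y.
Proof. by case: x => ? ?; case: y. Qed.

Lemma ReD (x y : R[i]) : Re (x + y) = Re x + Re y.
Proof. by case: x => ? ?; case: y. Qed.

Lemma ImD (x y : R[i]) : Im (x + y) = Im x + Im y.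
Proof. by case: x => ? ?; case: y. Qed.

Lemma complexP (x y : R[i]) : Re x = Re y -> Im x = Im y -> x = y.
Proof. by case: x => ? ?; case: y => ? ? /= -> ->. Qed.

Lemma normc_ge0 (x : R[i]) : 0 <= normc x.
Proof. by case: x => ? ?; exact: sqrtr_ge0. Qed.

Lemma normRe (x : R[i]) : `|Re x| <= normc x.
Proof.
by case: x => a b /=; rewrite -sqrtr_sqr ler_wsqrtr// lerDl sqr_ge0.
Qed.

Lemma normIm (x : R[i]) : `|Im x| <= normc x.
Proof.
by case: x => a b /=; rewrite -sqrtr_sqr ler_wsqrtr// lerDr sqr_ge0.
Qed.

Lemma normc_le_ReIm (x : R[i]) : normc x <= `|Re x| + `|Im x|.
Proof.
case: x => a b /=; rewrite -[leRHS]ger0_norm ?addr_ge0// -sqrtr_sqr ler_wsqrtr//.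
by rewrite sqrrD !real_normK ?num_real// addrAC lerDl mulrn_wge0// mulr_ge0.
Qed.

Lemma normc_cis (x : R) : normc (cis x) = 1.
Proof. by rewrite /= cos2Dsin2 sqrtr1. Qed.

(** The analogue of [Cmeasurable] over any domain: Fubini needs it on [R * R]. *)
Definition cmeasurable d (T : measurableType d) (h : T -> R[i]) :=
  measurable_fun setT (fun x => Re (h x)) /\ measurable_fun setT (fun x => Im (h x)).

Lemma cmeasurableM d (T : measurableType d) (f g : T -> R[i]) :
  cmeasurable f -> cmeasurable g -> cmeasurable (fun x => f x * g x).
Proof.
move=> [f1 f2] [g1 g2]; split.
  rewrite (_ : (fun _ => _) = fun x => Re (f x) * Re (g x) - Im (f x) * Im (g x)).
    by apply: measurable_funB; exact: measurable_funM.
  by apply/funext => x; rewrite ReM.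
rewrite (_ : (fun _ => _) = fun x => Re (f x) * Im (g x) + Im (f x) * Re (g x)).
  by apply: measurable_funD; exact: measurable_funM.
by apply/funext => x; rewrite ImM.
Qed.

Lemma cmeasurable_comp d d' (T : measurableType d) (U : measurableType d')
  (f : U -> R[i]) (g : T -> U) : cmeasurable f -> measurable_fun setT g ->
  cmeasurable (fun x => f (g x)).
Proof.
by move=> [f1 f2] mg; split; [exact: (measurableT_comp f1)|exact: (measurableT_comp f2)].
Qed.

Lemma cmeasurable_cis d (T : measurableType d) (g : T -> R) :
  measurable_fun setT g -> cmeasurable (fun x => cis (g x)).
Proof.
move=> mg; split.
- apply: (measurableT_comp (continuous_measurable_fun _) mg); exact: continuous_cos.
- apply: (measurableT_comp (continuous_measurable_fun _) mg); exact: continuous_sin.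
Qed.

Lemma measurable_normc (g : R -> R[i]) : Cmeasurable g ->
  measurable_fun setT (fun x => normc (g x)).
Proof.
move=> [m1 m2].
rewrite (_ : (fun _ => _) = fun x => Num.sqrt (reF g x ^+ 2 + imF g x ^+ 2)).
  apply: (measurableT_comp (continuous_measurable_fun _)).
    exact: sqrt_continuous.
  by apply: measurable_funD; exact: measurable_funX.
by apply/funext => x; rewrite /reF /imF; case: (g x).
Qed.

Definition cintegrable (g : R -> R[i]) := intble (reF g) /\ intble (imF g).

Lemma cintegrable_meas g : cintegrable g -> Cmeasurable g.
Proof. by move=> [/intble_meas ? /intble_meas ?]. Qed.

Lemma cintegrable_dom (g : R -> R[i]) (h : R -> R) : Cmeasurable g -> intble h ->
  (forall x, normc (g x) <= h x) -> cintegrable g.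
Proof.
move=> [m1 m2] ih gh; split.
- by apply: (intble_dom m1 ih) => x; exact: le_trans (normRe _) (gh x).
- by apply: (intble_dom m2 ih) => x; exact: le_trans (normIm _) (gh x).
Qed.

Lemma intble_normc g : cintegrable g -> intble (fun x => normc (g x)).
Proof.
move=> /[dup] /cintegrable_meas mg [i1 i2].
apply: (@intble_dom _ _ (fun x => `|reF g x| + `|imF g x|)).
- exact: measurable_normc.
- by apply: intbleD; exact: integrable_norm.
- by move=> x; rewrite ger0_norm ?normc_ge0// normc_le_ReIm.
Qed.

Lemma cintegrable_ae (u v : R -> R[i]) : Cmeasurable u -> cintegrable v ->
  (\forall x \ae mu, u x = v x) -> cintegrable u.
Proof.
move=> [m1 m2] [i1 i2] uv; split.
- by apply: (intble_ae m1 i1); apply: filterS uv => x uv; rewrite /reF uv.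
- by apply: (intble_ae m2 i2); apply: filterS uv => x uv; rewrite /imF uv.
Qed.

Lemma cmeasurable_real (w : R -> R) : measurable_fun setT w ->
  Cmeasurable (fun x => (w x)%:C).
Proof. by move=> mw; split => //; exact: measurable_cst. Qed.

Lemma normc_real (x : R) : normc x%:C = `|x|.
Proof. by rewrite /= expr0n/= addr0 sqrtr_sqr. Qed.

Lemma cintegrableMb (g h : R -> R[i]) M : cintegrable g -> Cmeasurable h ->
  (forall x, normc (h x) <= M) -> cintegrable (fun x => h x * g x).
Proof.
move=> gi mh hM; apply: (@cintegrable_dom _ (fun x => M * normc (g x))).
- exact: (cmeasurableM mh (cintegrable_meas gi)).
- exact/intbleZ/intble_normc.
- by move=> x; rewrite normcM ler_wpM2r ?normc_ge0.
Qed.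

Lemma cintegrableZ (c : R[i]) g : cintegrable g -> cintegrable (fun x => c * g x).
Proof.
move=> gi; apply: (cintegrableMb gi (h := fun=> c) (M := normc c)) => //.
by split; exact: measurable_cst.
Qed.

Lemma cintegrableD f g : cintegrable f -> cintegrable g ->
  cintegrable (fun x => f x + g x).
Proof.
move=> [f1 f2] [g1 g2]; split.
- have := intbleD f1 g1; by apply: eq_integrable => // x _; rewrite /= /reF ReD.
- have := intbleD f2 g2; by apply: eq_integrable => // x _; rewrite /= /imF ImD.
Qed.

Lemma CintegralD f g : cintegrable f -> cintegrable g ->
  Cintegral setT (fun x => f x + g x) = Cintegral setT f + Cintegral setT g.
Proof.
move=> [f1 f2] [g1 g2]; apply: complexP; rewrite ?ReD ?ImD /=.
- rewrite -RintegralD//; apply: eq_Rintegral => x _; exact: ReD.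
- rewrite -RintegralD//; apply: eq_Rintegral => x _; exact: ImD.
Qed.

Lemma CintegralZ (c : R[i]) g : cintegrable g ->
  Cintegral setT (fun x => c * g x) = c * Cintegral setT g.
Proof.
move=> [g1 g2]; apply: complexP; rewrite ?ReM ?ImM /=.
- rewrite -!RintegralZl// -RintegralB//; [|exact: intbleZ..].
  by apply: eq_Rintegral => x _; exact: ReM.
- rewrite -!RintegralZl// -RintegralD//; [|exact: intbleZ..].
  by apply: eq_Rintegral => x _; exact: ImM.
Qed.

Lemma CintegralN g : cintegrable g ->
  Cintegral setT (fun x => - g x) = - Cintegral setT g.
Proof.
move=> gi; rewrite -[RHS]mulN1r -CintegralZ//; congr Cintegral.
by apply/funext => x; rewrite mulN1r.
Qed.

Lemma CintegralB f g : cintegrable f -> cintegrable g ->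
  Cintegral setT (fun x => f x - g x) = Cintegral setT f - Cintegral setT g.
Proof.
move=> fi gi; rewrite -(CintegralN gi) -CintegralD//.
have := cintegrableZ (-1) gi; congr cintegrable.
by apply/funext => x; rewrite mulN1r.
Qed.

(** The factor 2 comes from estimating the two components separately. It enters only boundedness and
    continuity estimates, whose constants are free. *)
Lemma normc_Cintegral g (h : R -> R) : Cmeasurable g -> intble h ->
  (forall x, normc (g x) <= h x) -> normc (Cintegral setT g) <= 2 * \int[mu]_x h x.
Proof.
move=> mg ih gh; have [i1 i2] := cintegrable_dom mg ih gh.
rewrite (le_trans (normc_le_ReIm _))// mulr2n mulrDl mul1r lerD//=.
- apply: (le_trans (le_normr_Rintegral measurableT i1)).
  apply: le_Rintegral; [by []|exact: integrable_norm|by []|].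
  by move=> x _; exact: le_trans (normRe _) (gh x).
- apply: (le_trans (le_normr_Rintegral measurableT i2)).
  apply: le_Rintegral; [by []|exact: integrable_norm|by []|].
  by move=> x _; exact: le_trans (normIm _) (gh x).
Qed.

Lemma Cintegral_ae_eq f g : Cmeasurable f -> Cmeasurable g ->
  (\forall x \ae mu, f x = g x) -> Cintegral setT f = Cintegral setT g.
Proof.
move=> [f1 f2] [g1 g2] fg; congr Complex; apply: Rintegral_ae_eq => //.
- by apply: filterS fg => x fg _; rewrite /reF fg.
- by apply: filterS fg => x fg _; rewrite /imF fg.
Qed.

Lemma Cintegral_mkcond (D : set R) g :
  Cintegral D g = Cintegral setT (fun x => if x \in D then g x else 0).
Proof.
rewrite /Cintegral Rintegral_mkcond [X in _ +i* X]Rintegral_mkcond.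
by congr (Complex _ _); apply: eq_Rintegral => x _; rewrite patchE /reF /imF; case: ifP.
Qed.

Lemma Cintegral_Fubini (h : R * R -> R[i]) (a b : R -> R) :
  cmeasurable h -> intble a -> intble b ->
  (forall x y, normc (h (x, y)) <= a x * b y) ->
  Cintegral setT (fun x => Cintegral setT (fun y => h (x, y))) =
  Cintegral setT (fun y => Cintegral setT (fun x => h (x, y))) /\
  cintegrable (fun x => Cintegral setT (fun y => h (x, y))).
Proof.
move=> [m1 m2] ia ib hab.
have [e1 i1] := Fubini_dominated m1 ia ib (fun x y => le_trans (normRe _) (hab x y)).
have [e2 i2] := Fubini_dominated m2 ia ib (fun x y => le_trans (normIm _) (hab x y)).
split; last by split; [exact: i1|exact: i2].
by apply: complexP; [exact: e1|exact: e2].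
Qed.

(** The common form of [schwartz_fourier], [hat1] and [Psi]: the last two become transforms of
    weighted copies of [f], so that one multiplication formula handles both. *)
Definition L1hat (g : R -> R[i]) (t : R) : R[i] :=
  Cintegral setT (fun s => cis (- (s * t)) * g s).

Lemma cmeasurable_cisM (t : R) : Cmeasurable (fun s => cis (- (s * t))).
Proof.
apply: cmeasurable_cis; apply: measurableT_comp => //.
exact: mulrr_measurable.
Qed.

Lemma cintegrable_cisM g (t : R) : cintegrable g ->
  cintegrable (fun s => cis (- (s * t)) * g s).
Proof.
move=> gi; apply: (cintegrableMb gi (cmeasurable_cisM t) (M := 1)) => s.
by rewrite normc_cis.
Qed.

Lemma L1hat_lin (a : R[i]) f g t : cintegrable f -> cintegrable g ->
  L1hat (fun s => a * f s + g s) t = a * L1hat f t + L1hat g t.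
Proof.
move=> fi gi; rewrite /L1hat -CintegralZ; last exact: cintegrable_cisM.
rewrite -CintegralD; [|exact/cintegrableZ/cintegrable_cisM|exact: cintegrable_cisM].
by congr Cintegral; apply/funext => s; rewrite mulrDr mulrCA.
Qed.

Lemma L1hat_ae_eq f g : cintegrable f -> cintegrable g ->
  (\forall x \ae mu, f x = g x) -> L1hat f = L1hat g.
Proof.
move=> fi gi fg; apply/funext => t; apply: Cintegral_ae_eq.
- exact/cintegrable_meas/cintegrable_cisM.
- exact/cintegrable_meas/cintegrable_cisM.
- by apply: filterS fg => x ->.
Qed.

Lemma L1hat_bounded g : cintegrable g -> exists C, forall t, normc (L1hat g t) <= C.
Proof.
move=> gi; exists (2 * \int[mu]_x normc (g x)) => t.
apply: normc_Cintegral; [exact/cintegrable_meas/cintegrable_cisM|exact: intble_normc|].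
by move=> x; rewrite normcM normc_cis mul1r.
Qed.

Lemma L1hat_mul f g : cintegrable f -> cintegrable g ->
  Cintegral setT (fun s => f s * L1hat g s) =
  Cintegral setT (fun t => g t * L1hat f t) /\
  cintegrable (fun s => f s * L1hat g s).
Proof.
move=> fi gi.
pose h (p : R * R) := f p.1 * (cis (- (p.2 * p.1)) * g p.2).
have mh : cmeasurable h.
  apply: cmeasurableM.
    exact: (cmeasurable_comp (cintegrable_meas fi) measurable_fst).
  apply: cmeasurableM; last first.
    exact: (cmeasurable_comp (cintegrable_meas gi) measurable_snd).
  apply: cmeasurable_cis; apply: measurableT_comp => //.
  by apply: measurable_funM; [exact: measurable_snd|exact: measurable_fst].
have hb x y : normc (h (x, y)) <= normc (f x) * normc (g y).
  by rewrite /h !normcM normc_cis mul1r.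
have [e i] := Cintegral_Fubini mh (intble_normc fi) (intble_normc gi) hb.
have E : (fun s => f s * L1hat g s) = fun s => Cintegral setT (fun y => h (s, y)).
  by apply/funext => s; exact: (esym (CintegralZ (f s) (cintegrable_cisM s gi))).
rewrite E; split; last exact: i.
rewrite e; congr Cintegral; apply/funext => t.
rewrite -(CintegralZ (g t) (cintegrable_cisM t fi)).
by congr Cintegral; apply/funext => s; rewrite /h/= (mulrC t s) mulrCA (mulrC (f s)) mulrCA.
Qed.

Definition ccontinuous (g : R -> R[i]) := continuous (reF g) /\ continuous (imF g).

Lemma Rintegral_continuous (F : R -> R -> R) (G : R -> R) :
  (forall x, intble (F x)) -> (forall y, continuous (F ^~ y)) -> intble G ->
  (forall x y, `|F x y| <= G y) -> continuous (fun x => \int[mu]_y F x y).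
Proof.
move=> iF cF iG FG t.
have It : t \in `](t - 1), (t + 1)[%classic.
  by rewrite inE/= in_itv/= gtrBl ltrDl ltr01.
apply: (@continuity_under_integral _ _ _ mu F setT measurableT (t - 1) (t + 1)
  (fun x _ => iF x) _ G iG _ t It).
- by apply: aeW => y _ x _; exact: cF.
- by move=> x _; apply: aeW => y _; exact: FG.
Qed.

(** For [hat1] this makes [Omega] twice differentiable in the classical sense; for [Psi] it supplies
    measurability. *)
Lemma L1hat_continuous g : cintegrable g -> ccontinuous (L1hat g).
Proof.
move=> gi.
have le1 x y : normc (cis (- (y * x)) * g y) <= normc (g y).
  by rewrite normcM normc_cis mul1r.
have dc (a b y x : R) : is_derive x 1 (fun x => cos (- (y * x)) * a + sin (- (y * x)) * b)
    (- (- y * sin (- y * x)) * a + cos (- y * x) * 0 +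
    (- y * cos (- y * x) * b + sin (- y * x) * 0)).
  apply: ider_ext (iderD (iderM (ider_cos (- y) x) (is_derive_cst a x 1))
    (iderM (ider_sin (- y) x) (is_derive_cst b x 1))) _ _ => [z|//].
  by rewrite !mulNr.
split.
- apply: (@Rintegral_continuous (fun x y => Re (cis (- (y * x)) * g y))
    (fun y => normc (g y))).
  + by move=> x; case: (cintegrable_cisM x gi).
  + move=> y; apply: derivable_continuous => x.
    have [d _] := dc (Re (g y)) (- Im (g y)) y x.
    rewrite (_ : (fun x => _) = (fun x => cos (- (y * x)) * Re (g y) +
      sin (- (y * x)) * - Im (g y))); first exact: d.
    by apply/funext => z; rewrite ReM mulrN.
  + exact: intble_normc.
  + by move=> x y; exact: le_trans (normRe _) (le1 x y).
- apply: (@Rintegral_continuous (fun x y => Im (cis (- (y * x)) * g y))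
    (fun y => normc (g y))).
  + by move=> x; case: (cintegrable_cisM x gi).
  + move=> y; apply: derivable_continuous => x.
    have [d _] := dc (Im (g y)) (Re (g y)) y x.
    rewrite (_ : (fun x => _) = (fun x => cos (- (y * x)) * Im (g y) +
      sin (- (y * x)) * Re (g y))); first exact: d.
    by apply/funext => z; rewrite ImM.
  + exact: intble_normc.
  + by move=> x y; exact: le_trans (normIm _) (le1 x y).
Qed.

End complex_integration.

(** * Primitives *)

Section primitive.
Context {R : realType}.
Local Notation mu := (@lebesgue_measure R).
Implicit Types g : R -> R.

Lemma continuous_intble_itv g (a b : R) : continuous g ->
  mu.-integrable `[a, b] (EFin \o g).
Proof.
move=> cg; apply: continuous_compact_integrable; first exact: segment_compact.
exact: continuous_subspaceT.
Qed.

Lemma Rintegral_chasles g (a b c : R) : continuous g -> a <= b -> b <= c ->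
  \int[mu]_(x in `[a, c]) g x - \int[mu]_(x in `[a, b]) g x =
  \int[mu]_(x in `[b, c]) g x.
Proof.
move=> cg ab bc.
rewrite (@Rintegral_itvB _ g (BLeft a) (BRight c) b); last 3 first.
- exact: continuous_intble_itv.
- by rewrite bnd_simp.
- by rewrite bnd_simp.
rewrite Rintegral_itv_obnd_cbnd; first by [].
apply: (integrableS _ _ _ (continuous_intble_itv b c cg)) => //.
exact: subset_itv_oc_cc.
Qed.

Definition primitive g (s : R) : R :=
  if 0 <= s then \int[mu]_(x in `[0, s]) g x else - \int[mu]_(x in `[s, 0]) g x.

Lemma primitive0 g : primitive g 0 = 0.
Proof. by rewrite /primitive lexx set_itv1 Rintegral_set1. Qed.

Lemma is_derive_primitive g (s : R) : continuous g ->
  is_derive s 1 (primitive g) (g s).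
Proof.
(* [a] lies to the left of both 0 and [s], so for [z] near [s] the primitive equals [F z - F 0] with
   a single base point, whatever the sign of [z]. *)
move=> cg; pose a := Num.min 0 s - 1.
have as_ : a < s by rewrite /a ltrBlDr gt_min ltrDl ltr01 orbT.
have a0 : a < 0 by rewrite /a ltrBlDr gt_min ltrDl ltr01.
pose F z := \int[mu]_(x in `[a, z]) g x.
have [dF F's] := @continuous_FTC1_closed R g a s (s + 1) (ltr_pwDr ltr01 (lexx s))
  (continuous_intble_itv _ _ cg) as_ (cg s).
have dFF : is_derive s 1 (fun z => F z - F 0) (g s).
  rewrite -[g s]subr0; apply: (iderB _ (is_derive_cst (F 0) s 1)).
  by apply: DeriveDef; [exact: dF|rewrite -derive1E].
apply: near_eq_is_derive dFF.
near=> z.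
have az : a <= z by apply: ltW; near: z; exact: lt_nbhsr.
rewrite /primitive; case: leP => z0.
  by rewrite -(@Rintegral_chasles g a 0 z)// ltW.
by rewrite -(@Rintegral_chasles g a z 0)// ?opprB// ltW.
Unshelve. all: end_near. Qed.

(** Turns a bound on the derivative into one on the function at the cost of a factor [|s|]. The
    bound on [|z|] is what allows a second use, where the derivative itself grows. *)
Lemma MVT0 (f f' : R -> R) (s : R) : (forall x : R, is_derive x 1 f (f' x)) ->
  f 0 = 0 -> exists2 z, `|z| <= `|s| & f s = s * f' z.
Proof.
move=> df f0.
have cf : continuous f by apply: derivable_continuous => x; have [] := df x.
have [s0|s0] := leP 0 s.
- have [z] := MVT_segment s0 (fun x _ => df x) (continuous_subspaceT cf).
  rewrite in_itv/= f0 !subr0 => /andP[z0 zs] ->.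
  by exists z; rewrite ?ger0_norm// mulrC.
- have [z] := MVT_segment (ltW s0) (fun x _ => df x) (continuous_subspaceT cf).
  rewrite in_itv/= f0 !sub0r => /andP[z0 zs] /eqP; rewrite eqr_oppLR => /eqP ->.
  by exists z; rewrite ?ler0_norm ?lerN2//; [exact: ltW|lra].
Qed.

End primitive.

(** * Integration by parts against Schwartz functions *)

Section complex_derivatives.
Context {R : realType}.
Local Notation mu := (@lebesgue_measure R).
Local Notation intble f := (mu.-integrable [set: R] (EFin \o f)).
Local Notation Re := complex.Re.
Local Notation Im := complex.Im.
Implicit Types (f g w : R -> R[i]) (phi : schwartz R).

Definition cder w w' := forall x : R,
  is_derive x 1 (reF w) (reF w' x) /\ is_derive x 1 (imF w) (imF w' x).

Lemma cder_continuous w w' : cder w w' -> ccontinuous w.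
Proof.
move=> d; split; apply: derivable_continuous => x; have [[d1 _] [d2 _]] := d x.
- exact: d1.
- exact: d2.
Qed.

Lemma cderB f f' g g' : cder f f' -> cder g g' ->
  cder (fun x => f x - g x) (fun x => f' x - g' x).
Proof.
move=> df dg x; have [f1 f2] := df x; have [g1 g2] := dg x; split.
- apply: ider_ext (iderB f1 g1) _ _ => [y|]; rewrite /reF.
    by case: (f y) (g y) => ? ? [].
  by case: (f' x) (g' x) => ? ? [].
- apply: ider_ext (iderB f2 g2) _ _ => [y|]; rewrite /imF.
    by case: (f y) (g y) => ? ? [].
  by case: (f' x) (g' x) => ? ? [].
Qed.

Lemma cderM f f' g g' : cder f f' -> cder g g' ->
  cder (fun x => f x * g x) (fun x => f' x * g x + f x * g' x).
Proof.
move=> df dg x; have [f1 f2] := df x; have [g1 g2] := dg x; split.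
- apply: ider_ext (iderB (iderM f1 g1) (iderM f2 g2)) _ _ => [y|]; rewrite /reF/imF.
    by rewrite ReM.
  by rewrite ReD !ReM; ring.
- apply: ider_ext (iderD (iderM f1 g2) (iderM f2 g1)) _ _ => [y|]; rewrite /reF/imF.
    by rewrite ImM.
  by rewrite ImD !ImM; ring.
Qed.

Lemma cderD (u u' v v' : R -> R[i]) : cder u u' -> cder v v' ->
  cder (fun x => u x + v x) (fun x => u' x + v' x).
Proof.
move=> du dv x; have [f1 f2] := du x; have [g1 g2] := dv x; split.
- apply: ider_ext (iderD f1 g1) _ _ => [y|]; rewrite /reF.
    by rewrite ReD.
  by rewrite ReD.
- apply: ider_ext (iderD f2 g2) _ _ => [y|]; rewrite /imF.
    by rewrite ImD.
  by rewrite ImD.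
Qed.

Lemma cder_cst (a : R[i]) : cder (fun=> a) (fun=> 0).
Proof. by move=> x; split; exact: is_derive_cst. Qed.

Lemma cderZ a (u u' : R -> R[i]) : cder u u' ->
  cder (fun x => a * u x) (fun x => a * u' x).
Proof.
move=> du; have := cderM (cder_cst a) du; congr cder.
by apply/funext => x; rewrite mul0r add0r.
Qed.

Lemma cder0_cst (u : R -> R[i]) x : cder u (fun=> 0) -> u x = u 0.
Proof.
move=> du; apply: complexP.
- by apply: (@is_derive_0_is_cst _ (reF u)) => y; have [] := du y.
- by apply: (@is_derive_0_is_cst _ (imF u)) => y; have [] := du y.
Qed.

Lemma ccontinuousB f g : ccontinuous f -> ccontinuous g ->
  ccontinuous (fun x => f x - g x).
Proof.
move=> [f1 f2] [g1 g2]; split => x.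
- rewrite (_ : reF _ = fun y => reF f y - reF g y).
    by apply: cvgB; [exact: f1|exact: g1].
  by apply/funext => y; rewrite /reF; case: (f y) (g y) => ? ? [].
- rewrite (_ : imF _ = fun y => imF f y - imF g y).
    by apply: cvgB; [exact: f2|exact: g2].
  by apply/funext => y; rewrite /imF; case: (f y) (g y) => ? ? [].
Qed.

Lemma ccontinuousM f g : ccontinuous f -> ccontinuous g ->
  ccontinuous (fun x => f x * g x).
Proof.
move=> [f1 f2] [g1 g2]; split => x.
- rewrite (_ : reF _ = fun y => reF f y * reF g y - imF f y * imF g y).
    by apply: cvgB; apply: cvgM; [exact: f1|exact: g1|exact: f2|exact: g2].
  by apply/funext => y; rewrite /reF ReM.
- rewrite (_ : imF _ = fun y => reF f y * imF g y + imF f y * reF g y).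
    by apply: cvgD; apply: cvgM; [exact: f1|exact: g2|exact: f2|exact: g1].
  by apply/funext => y; rewrite /imF ImM.
Qed.

Lemma ccontinuous_meas f : ccontinuous f -> Cmeasurable f.
Proof. by move=> [f1 f2]; split; exact: continuous_measurable_fun. Qed.

Lemma Cintegral_cder0 (G g : R -> R[i]) (C : R) : cder G g -> ccontinuous g ->
  cintegrable g -> (forall x, normc (G x) <= C / (1 + x ^+ 2)) ->
  Cintegral setT g = 0.
Proof.
move=> dG [c1 c2] [i1 i2] GC; apply: complexP.
- apply: (@integral_derive_eq0 _ (reF G) (reF g) C) => // x.
    by have [] := dG x.
  exact: le_trans (normRe _) (GC x).
- apply: (@integral_derive_eq0 _ (imF G) (imF g) C) => // x.
    by have [] := dG x.
  exact: le_trans (normIm _) (GC x).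
Qed.

Lemma is_schwartzP phi : is_schwartz phi.
Proof. by have /asboolP := schwartz_valP phi. Qed.

Lemma schwartz_cder phi : cder phi (schwartz_derive phi).
Proof.
move=> x; have [d _] := is_schwartzP phi; have [d1 d2] := d 0%N x.
split; apply: DeriveDef; [exact: d1| |exact: d2|].
- by rewrite -derive1E.
- by rewrite -derive1E.
Qed.

Lemma schwartz_continuous phi : ccontinuous phi.
Proof. exact: cder_continuous (schwartz_cder phi). Qed.

(** [2 (1 + x^4) - (1 + x^2)^2 = (1 - x^2)^2]. Of the two powers of [1 + x^2] gained, one absorbs
    quadratic growth and the other leaves an integrable majorant. *)
Lemma quartic_decay (y x M N : R) : 0 <= y -> y <= M -> `|x| ^+ 4 * y <= N ->
  y <= 2 * (M + N) / (1 + x ^+ 2) ^+ 2.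
Proof.
move=> y0 yM; rewrite (_ : `|x| ^+ 4 = (x ^+ 2) ^+ 2); last first.
  by rewrite -(real_normK (num_real x)) -exprM.
move=> yN; have p : 0 < 1 + x ^+ 2 by rewrite ltr_wpDr ?sqr_ge0.
rewrite ler_pdivlMr ?exprn_gt0//.
apply: (@le_trans _ _ (y * (2 * (1 + (x ^+ 2) ^+ 2)))).
  rewrite ler_wpM2l// -subr_ge0.
  rewrite (_ : _ - _ = (1 - x ^+ 2) ^+ 2); [exact: sqr_ge0|ring].
rewrite mulrCA ler_pM2l// mulrDr mulr1 lerD//.
by rewrite mulrC.
Qed.

Lemma schwartz_seminormP m n phi x :
  `|x| ^+ m * normc (iter n Cderive phi x) <= schwartz_seminorm m n phi.
Proof.
have [_ /(_ m n)[M HM]] := is_schwartzP phi.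
by apply: ub_le_sup; [exists M => _ [y _ <-]; exact: HM|exists x].
Qed.

(** The constant is kept as an explicit sum of seminorms because temperedness requires a bound
    linear in them. *)
Lemma schwartz_decay phi n x : normc (iter n Cderive phi x) <=
  2 * (schwartz_seminorm 0 n phi + schwartz_seminorm 4 n phi) / (1 + x ^+ 2) ^+ 2.
Proof.
apply: quartic_decay; [exact: normc_ge0| |exact: schwartz_seminormP].
by have := schwartz_seminormP 0 n phi x; rewrite expr0 mul1r.
Qed.

Lemma growth_mul_decay w phi (C N : R) :
  (forall x, normc (w x) <= C * (1 + x ^+ 2)) ->
  (forall x, normc (phi x) <= N / (1 + x ^+ 2) ^+ 2) ->
  forall x, normc (w x * phi x) <= C * N / (1 + x ^+ 2).
Proof.
move=> wC pN x; have p : 0 < 1 + x ^+ 2 by rewrite ltr_wpDr ?sqr_ge0.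
rewrite normcM (le_trans (ler_pM (normc_ge0 _) (normc_ge0 _) (wC x) (pN x)))//.
rewrite le_eqVlt; apply/orP; left; apply/eqP; field.
by rewrite gt_eqF.
Qed.

Lemma growth_schwartz_cintegrable w phi (C : R) : Cmeasurable w ->
  (forall x, normc (w x) <= C * (1 + x ^+ 2)) -> cintegrable (fun x => w x * phi x).
Proof.
move=> mw wC; have pN := schwartz_decay phi 0.
apply: (cintegrable_dom _ (intbleZ _ intble_oneDsqrV)).
  exact: cmeasurableM mw (ccontinuous_meas (schwartz_continuous phi)).
exact: growth_mul_decay wC pN.
Qed.

Lemma schwartz_cintegrable phi : cintegrable phi.
Proof.
have := @growth_schwartz_cintegrable (fun=> 1) phi 1.
have -> : (fun x => 1 * phi x) = phi by apply/funext => x; rewrite mul1r.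
apply; first by split; exact: measurable_cst.
by move=> x; rewrite /= expr1n expr0n/= addr0 sqrtr1 mul1r lerDl sqr_ge0.
Qed.

(** Both integrations by parts are done at once: [w phi'' - w2 phi] is the derivative of
    [w phi' - w1 phi], which decays like [1 / (1 + x^2)]. *)
Lemma Cintegral_parts2 w w1 w2 phi (C : R) :
  cder w w1 -> cder w1 w2 -> ccontinuous w2 ->
  (forall x, normc (w x) <= C * (1 + x ^+ 2)) ->
  (forall x, normc (w1 x) <= C * (1 + x ^+ 2)) ->
  (forall x, normc (w2 x) <= C * (1 + x ^+ 2)) ->
  Cintegral setT (fun x => w x * schwartz_derive (schwartz_derive phi) x) =
  Cintegral setT (fun x => w2 x * phi x).
Proof.
move=> d0 d1 c2 b0 b1 b2.
set p1 := schwartz_derive phi; set p2 := schwartz_derive p1.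
have m0 := ccontinuous_meas (cder_continuous d0).
have m2 := ccontinuous_meas c2.
have i0 := growth_schwartz_cintegrable p2 m0 b0.
have i2 := growth_schwartz_cintegrable phi m2 b2.
apply/eqP; rewrite -subr_eq0 -CintegralB//; apply/eqP.
have bN := schwartz_decay p1 0; have bN' := schwartz_decay phi 0.
apply: (@Cintegral_cder0 (fun x => w x * p1 x - w1 x * phi x) _ (C * _ + C * _)).
- have := cderB (cderM d0 (schwartz_cder p1)) (cderM d1 (schwartz_cder phi)).
  congr cder; apply/funext => x.
  have E (a b c : R[i]) : a + b - (c + a) = b - c by ring.
  exact: E.
- apply: ccontinuousB; apply: ccontinuousM => //.
  + exact: cder_continuous d0.
  + exact: schwartz_continuous.
  + exact: schwartz_continuous.
- have := cintegrableD i0 (cintegrableZ (-1) i2); congr cintegrable.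
  by apply/funext => x; rewrite mulN1r.
- move=> x; rewrite (le_trans (le_normcD _ _))// normcN mulrDl lerD//.
    exact: growth_mul_decay b0 bN x.
  exact: growth_mul_decay b1 bN' x.
Qed.

(** The scalar [a] makes the derivative an instance of the same form, so the lemma can be
    iterated. *)
Lemma cder_cis (a : R[i]) (t : R) :
  cder (fun s => a * cis (- (s * t))) (fun s => a * (0 +i* - t) * cis (- (s * t))).
Proof.
move=> x; have dc := ider_cos (- t) x; have ds := ider_sin (- t) x.
have e (y : R) : - (y * t) = - t * y by rewrite mulNr mulrC.
split.
- apply: ider_ext (iderB (iderZ (Re a) dc) (iderZ (Im a) ds)) _ _ => [y|].
    by rewrite /reF ReM /= e.
  by rewrite /reF !ReM ImM /= e; ring.
- apply: ider_ext (iderD (iderZ (Re a) ds) (iderZ (Im a) dc)) _ _ => [y|].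
    by rewrite /imF ImM /= e.
  by rewrite /imF !ImM ReM /= e; ring.
Qed.

Lemma L1hat_derive2 phi (t : R) :
  L1hat (schwartz_derive (schwartz_derive phi)) t = - (t ^+ 2)%:C * L1hat phi t.
Proof.
pose a : R[i] := 0 +i* - t.
have a2 : a * a = - (t ^+ 2)%:C by apply: complexP => /=; ring.
rewrite -[RHS](CintegralZ _ (cintegrable_cisM t (schwartz_cintegrable phi))).
have d0 := cder_cis 1 t; have d1 := cder_cis (1 * a) t.
(* A single constant has to dominate [w], [w1] and [w2] in [Cintegral_parts2]; the sum of the three
   moduli does. *)
pose C := normc (1 : R[i]) + normc (1 * a) + normc (1 * a * a).
have bC (b : R[i]) x : normc b <= C -> normc (b * cis (- (x * t))) <= C * (1 + x ^+ 2).
  move=> bC; rewrite normcM normc_cis mulr1 (le_trans bC)// ler_peMr ?lerDl ?sqr_ge0//.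
  exact: le_trans (normc_ge0 _) bC.
have := @Cintegral_parts2 _ _ _ phi C d0 d1
  (cder_continuous (cder_cis (1 * a * a) t)).
move=> H; rewrite /L1hat.
transitivity (Cintegral [set: R] (fun s => 1 * cis (- (s * t)) *
    schwartz_derive (schwartz_derive phi) s)).
  by congr Cintegral; apply/funext => s; rewrite mul1r.
rewrite H.
- by congr Cintegral; apply/funext => s; rewrite mul1r a2 mulrA.
- by move=> x; apply: bC; rewrite /C -addrA lerDl addr_ge0 ?normc_ge0.
- by move=> x; apply: bC; rewrite /C addrAC lerDr addr_ge0 ?normc_ge0.
- by move=> x; apply: bC; rewrite /C lerDr addr_ge0 ?normc_ge0.
Qed.

End complex_derivatives.

(** * The Banach space of essentially bounded functions *)

Section Linf_facts.
Local Open Scope quotient_scope.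
Context {R : realType}.
Local Notation mu := (@lebesgue_measure R).
Implicit Types f g : Linf R.

Lemma lebesgue_measureT_gt0 : (0 < mu [set: R])%E.
Proof. by rewrite -set_itvNyy lebesgue_measure_itv/= adde_gt0. Qed.

Lemma ess_normE (h : R -> R[i]) : ess_norm h = ess_sup mu (EFin \o (@normc R \o h)).
Proof.
rewrite /ess_norm unlock lebesgue_measureT_gt0; congr ess_sup; apply/funext => x /=.
by congr _%:E; rewrite ger0_norm// normc_ge0.
Qed.

Lemma Linf_valP f : Cmeasurable f /\ (ess_norm f < +oo)%E.
Proof. by have /asboolP := ess_bounded_valP (repr f). Qed.

Lemma Linf_meas f : Cmeasurable f.
Proof. by have [] := Linf_valP f. Qed.

Lemma ess_norm_ge0 (h : R -> R[i]) : (0 <= ess_norm h)%E.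
Proof.
rewrite ess_normE; apply: ess_sup_ger; first exact: lebesgue_measureT_gt0.
by move=> t; rewrite lee_fin normc_ge0.
Qed.

Lemma Linf_normE f : ess_norm f = (Linf_norm f)%:E.
Proof.
rewrite /Linf_norm fineK// ge0_fin_numE ?ess_norm_ge0//.
by have [] := Linf_valP f.
Qed.

Lemma Linf_norm_ge0 f : 0 <= Linf_norm f.
Proof. by rewrite -lee_fin -Linf_normE ess_norm_ge0. Qed.

Lemma Linf_bound f : \forall x \ae mu, normc (f x) <= Linf_norm f.
Proof.
have : (ess_norm f <= (Linf_norm f)%:E)%E by rewrite Linf_normE.
by rewrite ess_normE => /ess_supP; apply: filterS => x; rewrite /= lee_fin.
Qed.

Lemma Linf_norm_le f (M : R) : (\forall x \ae mu, normc (f x) <= M) ->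
  Linf_norm f <= M.
Proof.
move=> fM; rewrite -lee_fin -Linf_normE ess_normE; apply/ess_supP.
by apply: filterS fM => x; rewrite /= lee_fin.
Qed.

(** [repr] picks an arbitrary member of the class, so computations with [Linf_fun] survive the
    quotient only almost everywhere. *)
Lemma repr_pi_ae (u : @ess_bounded_fun R) :
  \forall x \ae mu, (repr (\pi_(Linf R) u) : ess_bounded_fun) x = u x.
Proof.
have : \pi_(Linf R) (repr (\pi_(Linf R) u)) = \pi_(Linf R) u by rewrite reprK.
move/eqP; rewrite -Quotient.idealrBE => /asboolP; apply: filterS => x /eqP.
by rewrite subr_eq0 => /eqP.
Qed.

Lemma Linf_ext f g : (\forall x \ae mu, f x = g x) -> f = g.
Proof.
move=> fg; rewrite -[f]reprK -[g]reprK; apply/eqP.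
rewrite -Quotient.idealrBE; apply/asboolP; apply: filterS fg => x fg.
by apply/eqP; rewrite subr_eq0; apply/eqP.
Qed.

Lemma Linf_lin (a : R[i]) f g : \forall x \ae mu, Linf_fun (a *: f + g) x = a * f x + g x.
Proof.
have -> : a *: f + g = \pi_(Linf R) (a *: repr f + repr g).
  by rewrite pi_Linf_add pi_scale !reprK.
exact: repr_pi_ae.
Qed.

Lemma Linf0 : \forall x \ae mu, Linf_fun (0 : Linf R) x = 0.
Proof.
have := Linf_lin (-1) 0 0; rewrite scaleN1r addNr; apply: filterS => x ->.
by rewrite mulN1r addNr.
Qed.

Lemma Linf_sub f g : \forall x \ae mu, Linf_fun (f - g) x = f x - g x.
Proof.
have := Linf_lin (-1) g f; rewrite scaleN1r addrC; apply: filterS => x ->.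
by rewrite mulN1r addrC.
Qed.

Lemma Linf_mk (h : R -> R[i]) (M : R) : Cmeasurable h ->
  (forall x, normc (h x) <= M) -> exists f, \forall x \ae mu, f x = h x.
Proof.
move=> mh hM.
have P : h \in (@ess_bounded R).
  by apply/asboolP; split => //; apply/ess_norm_ltyP; exists M; exact: nearW.
by exists (\pi_(Linf R) (EssBoundedFun P)); exact: repr_pi_ae.
Qed.

(** Setting [f] to 0 where it exceeds its norm gives a measurable version bounded at every point, as
    the domination arguments and [gauss_orthogonal_eq0] demand. *)
Lemma Linf_rep f : exists2 h : R -> R[i],
  Cmeasurable h /\ (forall x, normc (h x) <= Linf_norm f) &
  \forall x \ae mu, f x = h x.
Proof.
have [m1 m2] := Linf_meas f.
pose A := [set x | normc (f x) <= Linf_norm f].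
have mA : measurable A.
  have mn := measurable_normc (Linf_meas f).
  rewrite (_ : A = [set: R] `&` (fun x => normc (f x)) @^-1` `]-oo, Linf_norm f]).
    exact: mn.
  by rewrite setTI; apply/seteqP; split => x /=; rewrite in_itv.
exists (fun x => if x \in A then f x else 0); last first.
  by apply: filterS (Linf_bound f) => x fx; rewrite mem_set.
split.
  split.
  - rewrite (_ : reF _ = (reF f) \_ A).
      by apply/(measurable_restrictT _ mA); exact: measurable_funTS.
    by apply/funext => x; rewrite patchE /reF; case: ifP.
  - rewrite (_ : imF _ = (imF f) \_ A).
      by apply/(measurable_restrictT _ mA); exact: measurable_funTS.
    by apply/funext => x; rewrite patchE /imF; case: ifP.
move=> x; case: ifPn => [/set_mem//|_].
by rewrite /= expr0n/= addr0 sqrtr0 Linf_norm_ge0.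
Qed.

Lemma Linf_norm_eq0 f : Linf_norm f = 0 -> f = 0.
Proof.
move=> f0; apply: Linf_ext; apply: filterS2 (Linf_bound f) Linf0 => x.
rewrite f0 => h ->; apply: eq0_normc; apply/eqP.
by rewrite eq_le h normc_ge0.
Qed.

Lemma Linf_normZ_le (a : R[i]) f : Linf_norm (a *: f) <= normc a * Linf_norm f.
Proof.
apply: Linf_norm_le; rewrite -[a *: f]addr0.
apply: filterS3 (Linf_lin a f 0) Linf0 (Linf_bound f) => x -> -> fx.
by rewrite addr0 normcM ler_wpM2l ?normc_ge0.
Qed.

Lemma Linf_normZ (a : R[i]) f : Linf_norm (a *: f) = normc a * Linf_norm f.
Proof.
apply/eqP; rewrite eq_le Linf_normZ_le/=.
have [->|a0] := eqVneq a 0.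
  by rewrite normc0 mul0r Linf_norm_ge0.
have na0 : 0 < normc a.
  by rewrite lt_def normc_ge0 andbT; apply: contra a0 => /eqP/eq0_normc ->.
have := Linf_normZ_le a^-1 (a *: f); rewrite scalerA mulVf// scale1r => h.
rewrite mulrC -ler_pdivlMr// mulrC (le_trans h)// ler_wpM2r ?Linf_norm_ge0//.
have : normc a^-1 * normc a = 1 by rewrite -normcM mulVf// normc1.
by move=> /(canRL (mulfK (lt0r_neq0 na0))) ->; rewrite mul1r.
Qed.

Lemma Linf_normD f g : Linf_norm (f + g) <= Linf_norm f + Linf_norm g.
Proof.
apply: Linf_norm_le; rewrite -[f]scale1r.
apply: filterS3 (Linf_lin 1 f g) (Linf_bound f) (Linf_bound g) => x -> fx gx.
rewrite mul1r (le_trans (le_normcD _ _))// lerD//.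
by rewrite scale1r.
Qed.

Lemma Linf_normed : normed_space [set: Linf R] (@Linf_norm R).
Proof.
split=> // [f _|a f _|f g _ _]; first exact: Linf_norm_eq0.
- exact: Linf_normZ.
- exact: Linf_normD.
Qed.

Lemma Linf_complete (u : nat -> Linf R) : cauchy_sequence (@Linf_norm R) u ->
  exists l, Linf_norm (u n - l) @[n --> \oo] --> (0 : R).
Proof.
move=> cu.
(* Only countably many inequalities are involved, so one null set [Z] contains all the exceptional
   points. *)
have [Z [mZ Z0 PZ]] : \forall x \ae mu, forall m n,
    normc (u m x - u n x) <= Linf_norm (u m - u n) /\ normc (u n x) <= Linf_norm (u n).
  apply: ae_foralln => m; apply: ae_foralln => n.
  apply: filterS3 (Linf_sub (u m) (u n)) (Linf_bound (u m - u n)) (Linf_bound (u n)).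
  by move=> x <-.
(* Vanishing on [Z], the [v n] satisfy the norm inequalities at every point, so they form a
   uniformly Cauchy sequence. *)
pose v n x : R[i] := if x \in ~` Z then u n x else 0.
have mZC : measurable (~` Z) by exact: measurableC.
have vu n : \forall x \ae mu, u n x = v n x.
  exists Z; split => // x /= uv; apply: contrapT => Zx; apply: uv.
  by rewrite /v mem_set.
have mv n : Cmeasurable (v n).
  have [m1 m2] := Linf_meas (u n); split.
  - rewrite (_ : reF _ = (reF (u n)) \_ (~` Z)).
      by apply/(measurable_restrictT _ mZC); exact: measurable_funTS.
    by apply/funext => x; rewrite patchE /reF /v; case: ifP.
  - rewrite (_ : imF _ = (imF (u n)) \_ (~` Z)).
      by apply/(measurable_restrictT _ mZC); exact: measurable_funTS.
    by apply/funext => x; rewrite patchE /imF /v; case: ifP.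
have vb m n x : normc (v m x - v n x) <= Linf_norm (u m - u n) /\
    normc (v n x) <= Linf_norm (u n).
  rewrite /v; case: ifPn => [/set_mem xZ|_].
    by apply: contrapT => H; apply: xZ; apply: PZ => /= H'; apply: H; exact: H'.
  by rewrite subrr normc0 !Linf_norm_ge0.
(* [p] stands for the real or the imaginary part: both are 1-Lipschitz, which reduces convergence to
   completeness of the reals. *)
have cvv (p : R[i] -> R) : (forall a b, `|p a - p b| <= normc (a - b)) ->
    forall x, cvg (p (v n x) @[n --> \oo]).
  move=> pl x; apply: cauchy_cvg; apply: cauchy_exP => e e0.
  have [n0 Hn0] := cu e e0; exists (p (v n0 x)).
  exists n0 => // n /= n0n; rewrite /ball/= (le_lt_trans (pl _ _))//.
  by rewrite (le_lt_trans (vb _ _ _).1)// Hn0.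
have Rel (a b : R[i]) : `|complex.Re a - complex.Re b| <= normc (a - b).
  by rewrite (_ : _ - _ = complex.Re (a - b)) ?normRe//; case: a b => ? ? [].
have Iml (a b : R[i]) : `|complex.Im a - complex.Im b| <= normc (a - b).
  by rewrite (_ : _ - _ = complex.Im (a - b)) ?normIm//; case: a b => ? ? [].
pose l x : R[i] := limn (fun n => complex.Re (v n x)) +i* limn (fun n => complex.Im (v n x)).
have ml : Cmeasurable l.
  split.
  - apply: (@measurable_fun_cvg _ _ _ setT (fun n x => complex.Re (v n x))) => //.
      by move=> n; have [] := mv n.
    by move=> x _; exact: (cvv _ Rel).
  - apply: (@measurable_fun_cvg _ _ _ setT (fun n x => complex.Im (v n x))) => //.
      by move=> n; have [] := mv n.
    by move=> x _; exact: (cvv _ Iml).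
have lim_le (p : R[i] -> R) (pl : forall a b, `|p a - p b| <= normc (a - b)) e n0 :
    (forall m n, (n0 <= m)%N -> (n0 <= n)%N -> Linf_norm (u m - u n) < e) ->
    forall n x, (n0 <= n)%N -> `|p (v n x) - limn (fun m => p (v m x))| <= e.
  move=> Hn0 n x n0n.
  have c : `|p (v n x) - p (v m x)| @[m --> \oo] -->
      `|p (v n x) - limn (fun m => p (v m x))|.
    by apply: cvg_norm; apply: cvgB; [exact: cvg_cst|exact: cvv].
  rewrite -(cvg_lim _ c)//; apply: limr_le; first by apply/cvg_ex; eexists; exact: c.
  exists n0 => // m /= n0m; rewrite (le_trans (pl _ _))//.
  by rewrite (le_trans (vb _ _ _).1)// ltW// Hn0.
(* One [e] for each component. *)
have vl e n0 : (forall m n, (n0 <= m)%N -> (n0 <= n)%N -> Linf_norm (u m - u n) < e) ->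
    forall n x, (n0 <= n)%N -> normc (v n x - l x) <= e + e.
  move=> Hn0 n x n0n; rewrite (le_trans (normc_le_ReIm _))// lerD//.
  - rewrite (_ : complex.Re _ = complex.Re (v n x) - complex.Re (l x)).
      exact: lim_le Rel _ _ Hn0 _ _ n0n.
    by case: (v n x) (l x) => ? ? [].
  - rewrite (_ : complex.Im _ = complex.Im (v n x) - complex.Im (l x)).
      exact: lim_le Iml _ _ Hn0 _ _ n0n.
    by case: (v n x) (l x) => ? ? [].
have [n1 Hn1] := cu 1 ltr01.
have [L HL] : exists L : Linf R, \forall x \ae mu, L x = l x.
  (* The limit is bounded because it stays within [1 + 1] of [v n1], by [vl] with [e = 1]. *)
  apply: (@Linf_mk _ (Linf_norm (u n1) + (1 + 1))) => // x.
  rewrite -[l x](subrK (v n1 x)) addrC (le_trans (le_normcD _ _))// lerD//.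
    by have [] := vb n1 n1 x.
  by rewrite -normcN opprB; exact: vl Hn1 _ _ (leqnn _).
exists L; apply/cvgrPdist_le => e e0.
(* Halving compensates the bound [e + e] in [vl]. *)
have [n0 Hn0] := cu (e / 2) (divr_gt0 e0 (ltr0n _ 2)).
exists n0 => // n /= n0n; rewrite sub0r normrN ger0_norm ?Linf_norm_ge0//.
apply: Linf_norm_le.
apply: filterS3 (Linf_sub (u n) L) (vu n) HL => x -> -> ->.
by rewrite [leRHS]splitr; exact: vl Hn0 _ _ n0n.
Qed.

Lemma Linf_banach : banach_space [set: Linf R] (@Linf_norm R).
Proof.
split; first exact: Linf_normed.
by move=> u _ /Linf_complete[l Hl]; exists l.
Qed.

End Linf_facts.

(** * Transport of Banach structure along isometric isomorphisms *)

Section transfer.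
Context {R : realType}.
Variables (E F : lmodType R[i]) (N : E -> R) (W : set F) (M : F -> R) (T : E -> F).
Hypotheses (BE : banach_space [set: E] N) (iso : isometric_isomorphism [set: E] N W M T).

Let Tlin a x y : T (a *: x + y) = a *: T x + T y.
Proof. by have [h _ _] := iso; exact: h. Qed.

Let T0 : T 0 = 0.
Proof.
have := Tlin (-1) 0 0; rewrite scaleN1r addNr => ->.
by rewrite scaleN1r addNr.
Qed.

Let TW x : W (T x).
Proof. by have [_ [h _ _] _] := iso; exact: h. Qed.

Let MT x : M (T x) = N x.
Proof. by have [_ _ h] := iso; exact: h. Qed.

Let surj y : W y -> exists x, T x = y.
Proof. by have [_ [_ _ h] _] := iso; move=> /h[x _ <-]; exists x. Qed.

Let TB x y : T (x - y) = T x - T y.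
Proof. by rewrite addrC -scaleN1r Tlin scaleN1r addrC. Qed.

Lemma banach_isometric : banach_space W M.
Proof.
have [[_ _ N0 NZ ND] comp] := BE; split.
- split.
  + by rewrite -T0; exact: TW.
  + by move=> a x y /surj[x' <-] /surj[y' <-]; rewrite -Tlin; exact: TW.
  + by move=> x /surj[x' <-]; rewrite MT => /N0 ->.
  + move=> a x /surj[x' <-]; rewrite MT -NZ// -MT; congr M.
    by rewrite -[a *: x']addr0 Tlin T0 addr0.
  + move=> x y /surj[x' <-] /surj[y' <-]; rewrite !MT -[T x']scale1r -Tlin scale1r MT.
    exact: ND.
- move=> u Wu cu.
  have /choice[v vu] : forall n, exists x, T x = u n by move=> n; exact: surj.
  have cv : cauchy_sequence N v.
    move=> e /cu[n0 H]; exists n0 => m n m0 n0n.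
    by rewrite -MT TB !vu; exact: H.
  have [l _ Hl] := comp v (fun=> I) cv; exists (T l); first exact: TW.
  rewrite (_ : (fun n => _) = fun n => N (v n - l)) //.
  by apply/funext => n; rewrite -vu -TB MT.
Qed.

End transfer.

Lemma isometric_trans (R : realType) (E F G : lmodType R[i]) (N : E -> R)
  (W : set F) (M : F -> R) (V : set G) (K : G -> R) (T : E -> F) (S : E -> G) :
  isometric_isomorphism [set: E] N W M T -> isometric_isomorphism [set: E] N V K S ->
  isometrically_isomorphic W M V K.
Proof.
move=> [Tl [TW Ti Ts] TM] [Sl [SV Si Ss] SK].
(* [T'] inverts [T] on [W]; outside [W] it takes the default value 0, which the conclusion never
   sees. *)
have /choice[T' T'K] : forall y, exists x, W y -> T x = y.
  move=> y; have [/Ts[x _ <-]|nWy] := pselect (W y); first by exists x.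
  by exists 0.
have TK x : T' (T x) = x by apply: Ti; rewrite ?inE//; apply: T'K; exact: TW.
exists (S \o T'); split.
- move=> a x y Wx Wy /=; rewrite -Sl//; congr S.
  by rewrite -{1}(T'K x Wx) -{1}(T'K y Wy) -Tl// TK.
- split.
  + by move=> y Wy /=; exact: SV.
  + move=> x y /set_mem Wx /set_mem Wy /= /Si; rewrite !inE => /(_ I I) e.
    by rewrite -(T'K x Wx) -(T'K y Wy) e.
  + move=> z /Ss[x _ <-]; exists (T x); first exact: TW.
    by rewrite /= TK.
- by move=> y Wy /=; rewrite SK// -TM// T'K.
Qed.

(** * The functions Omega, Psi and Phi *)

Section distribution.
Context {R : realType}.
Local Notation mu := (@lebesgue_measure R).
Local Notation intble f := (mu.-integrable [set: R] (EFin \o f)).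
Local Notation Re := complex.Re.
Local Notation Im := complex.Im.
Implicit Types (f g : Linf R) (phi : schwartz R).

Lemma weight_cintegrable (w : R -> R) f : intble w ->
  cintegrable (fun t => (w t)%:C * f t).
Proof.
move=> iw; have mw := intble_meas iw; have [h [mh hM] fh] := Linf_rep f.
apply: (@cintegrable_ae _ _ (fun t => (w t)%:C * h t)).
- exact: (cmeasurableM (cmeasurable_real mw) (Linf_meas f)).
- apply: (@cintegrable_dom _ _ (fun t => Linf_norm f * `|w t|)).
  + exact: (cmeasurableM (cmeasurable_real mw) mh).
  + exact/intbleZ/integrable_norm.
  + by move=> x; rewrite normcM normc_real mulrC ler_wpM2r.
- by apply: filterS fh => x ->.
Qed.

Lemma weight_L1hat_lin (w : R -> R) (a : R[i]) f g s : intble w ->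
  L1hat (fun t => (w t)%:C * (a *: f + g : Linf R) t) s =
  a * L1hat (fun t => (w t)%:C * f t) s + L1hat (fun t => (w t)%:C * g t) s.
Proof.
move=> iw; have fi := weight_cintegrable f iw; have gi := weight_cintegrable g iw.
rewrite -(L1hat_lin a s fi gi); congr (_ s).
apply: L1hat_ae_eq; [exact: weight_cintegrable|exact: cintegrableD (cintegrableZ a fi) gi|].
by apply: filterS (Linf_lin a f g) => x ->; rewrite mulrDr mulrCA.
Qed.

Definition low_weight : R -> R := \1_(`[-1, 1]).

(* Outside [-1, 1] the maximum is t^2; taking it makes the inverse continuous. *)
Definition high_weight (t : R) : R := \1_(~` `[-1, 1]) t * (Num.max 1 (t ^+ 2))^-1.

Lemma low_weight_intble : intble low_weight.
Proof. exact: integrable_indic_itv. Qed.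

Lemma high_weight_intble : intble high_weight.
Proof.
have m1 (t : R) : 0 < Num.max 1 (t ^+ 2) by rewrite lt_max ltr01.
(* The factor 2 comes from [1 + t^2 <= 2 max (1, t^2)]. *)
apply: (@intble_dom _ _ (fun t => 2 * (1 + t ^+ 2)^-1)).
- apply: measurable_funM; first by apply: measurable_indic; exact: measurableC.
  apply: continuous_measurable_fun => t; apply: cvgV; first by rewrite gt_eqF.
  exact: (continuous_max (@cst_continuous _ _ (1 : R) t) (@exprn_continuous _ 2 t)).
- exact/intbleZ/intble_oneDsqrV.
- move=> t; have i0 : 0 <= (Num.max 1 (t ^+ 2))^-1 by rewrite invr_ge0; exact: ltW.
  rewrite normrM ger0_norm// [`|_^-1|]ger0_norm//.
  rewrite (@le_trans _ _ (Num.max 1 (t ^+ 2))^-1)//.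
    by rewrite ler_piMl// indicE lern1 leq_b1.
  have p : 0 < 1 + t ^+ 2 by rewrite ltr_wpDr ?sqr_ge0.
  rewrite -[leLHS]mul1r ler_pdivrMr// mulrAC ler_pdivlMr// mul1r.
  by rewrite mulr_natl mulr2n lerD// le_max lexx ?orbT.
Qed.

Lemma weightsE (t : R) : low_weight t + high_weight t * t ^+ 2 = 1.
Proof.
rewrite /low_weight /high_weight !indicE in_setC.
have [/set_mem /=|] := boolP (t \in `[-1, 1]%classic); first by rewrite mul0r mul0r addr0.
rewrite add0r mul1r notin_setE /= in_itv/= -ler_norml => /negP; rewrite -ltNge => t1.
have t2 : 1 < t ^+ 2 by rewrite -(real_normK (num_real t)) exprn_egt1.
by rewrite max_r ?ltW// mulVf// gt_eqF// (lt_trans ltr01).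
Qed.

Lemma hat1E f : hat1 f = L1hat (fun t => (low_weight t)%:C * f t).
Proof.
apply/funext => s; rewrite /hat1 /L1hat Cintegral_mkcond; congr Cintegral.
apply/funext => t; rewrite /low_weight indicE (mulrC s).
by case: ifP => _; rewrite ?mul1r ?mul0r ?mulr0.
Qed.

Lemma PsiE f : Psi f = L1hat (fun t => (high_weight t)%:C * f t).
Proof.
apply/funext => s; rewrite /Psi /L1hat Cintegral_mkcond; congr Cintegral.
apply/funext => t; rewrite /high_weight indicE (mulrC s).
have -> : (t \in [set t | 1 < `|t|]) = (t \in ~` `[-1, 1]%classic).
  by apply: asbool_equiv_eq; rewrite /= in_itv/= -ler_norml ltNge; split => /negP.
case: ifPn => [|_]; last by rewrite !mul0r mulr0.
rewrite in_setE /= in_itv/= -ler_norml => /negP; rewrite -ltNge => t1.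
have t2 : 1 < t ^+ 2 by rewrite -(real_normK (num_real t)) exprn_egt1.
rewrite mul1r max_r ?ltW// fmorphV /= -!mulrA; congr (_ * _); exact: mulrC.
Qed.

Lemma oriented_CintegralE (g : R -> R[i]) s :
  oriented_Cintegral 0 s g = primitive (reF g) s +i* primitive (imF g) s.
Proof. by rewrite /oriented_Cintegral /primitive; case: ifP. Qed.

Lemma oriented_Cintegral0 (g : R -> R[i]) : oriented_Cintegral 0 0 g = 0.
Proof. by rewrite oriented_CintegralE !primitive0. Qed.

Lemma cder_oriented (g : R -> R[i]) : ccontinuous g ->
  cder (fun s => oriented_Cintegral 0 s g) g.
Proof.
move=> [c1 c2] x; split.
- by apply: ider_ext (is_derive_primitive x c1) _ _ => // y; rewrite /reF oriented_CintegralE.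
- by apply: ider_ext (is_derive_primitive x c2) _ _ => // y; rewrite /imF oriented_CintegralE.
Qed.

(** Both sides vanish at 0 and have the same derivative; this avoids distinguishing the sign of
    [s]. *)
Lemma oriented_lin a (g h : R -> R[i]) s : ccontinuous g -> ccontinuous h ->
  ccontinuous (fun x => a * g x + h x) ->
  oriented_Cintegral 0 s (fun x => a * g x + h x) =
  a * oriented_Cintegral 0 s g + oriented_Cintegral 0 s h.
Proof.
move=> cg ch cgh.
have d := cderB (cder_oriented cgh) (cderD (cderZ a (cder_oriented cg)) (cder_oriented ch)).
rewrite (_ : (fun x => a * g x + h x - (a * g x + h x)) = fun=> 0) in d; last first.
  by apply/funext => x; rewrite subrr.
have := cder0_cst s d; rewrite !oriented_Cintegral0 mulr0 addr0 subrr.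
by move/eqP; rewrite subr_eq0 => /eqP.
Qed.

Lemma hat1_continuous f : ccontinuous (hat1 f).
Proof. by rewrite hat1E; exact/L1hat_continuous/weight_cintegrable/low_weight_intble. Qed.

Lemma Psi_continuous f : ccontinuous (Psi f).
Proof. by rewrite PsiE; exact/L1hat_continuous/weight_cintegrable/high_weight_intble. Qed.

Lemma hat1_lin a f g s : hat1 (a *: f + g) s = a * hat1 f s + hat1 g s.
Proof. by rewrite !hat1E weight_L1hat_lin//; exact: low_weight_intble. Qed.

Definition Omega1 f s := oriented_Cintegral 0 s (hat1 f).

Lemma Omega1_continuous f : ccontinuous (Omega1 f).
Proof. exact/cder_continuous/cder_oriented/hat1_continuous. Qed.

Lemma cder_Omega f : cder (Omega f) (Omega1 f).
Proof. exact/cder_oriented/Omega1_continuous. Qed.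

Lemma Phi_lin a f g : Phi (a *: f + g) = a *: Phi f + Phi g.
Proof.
have h1 : hat1 (a *: f + g) = fun s => a * hat1 f s + hat1 g s.
  by apply/funext => s; exact: hat1_lin.
have o1 : Omega1 (a *: f + g) = fun s => a * Omega1 f s + Omega1 g s.
  apply/funext => s; rewrite /Omega1 h1; apply: oriented_lin; [exact: hat1_continuous..|].
  by rewrite -h1; exact: hat1_continuous.
apply/funext => s.
rewrite -[LHS]/(Omega (a *: f + g) s - Psi (a *: f + g) s).
rewrite -[RHS]/(a * (Omega f s - Psi f s) + (Omega g s - Psi g s)).
have -> : Omega (a *: f + g) s = a * Omega f s + Omega g s.
  rewrite -[LHS]/(oriented_Cintegral 0 s (Omega1 (a *: f + g))) o1.
  apply: oriented_lin; [exact: Omega1_continuous..|].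
  by rewrite -o1; exact: Omega1_continuous.
have -> : Psi (a *: f + g) s = a * Psi f s + Psi g s.
  by rewrite !PsiE; exact: weight_L1hat_lin high_weight_intble.
have E (p q r t : R[i]) : a * p + q - (a * r + t) = a * (p - r) + (q - t) by ring.
exact: E.
Qed.

(** [hat1 f] is bounded, and each integration from 0 costs a factor [2 |s|], the 2 accounting for
    the two components. *)
Lemma Omega_growth f : exists C : R, [/\ forall s, normc (hat1 f s) <= C * (1 + s ^+ 2),
  forall s, normc (Omega1 f s) <= C * (1 + s ^+ 2) &
  forall s, normc (Omega f s) <= C * (1 + s ^+ 2)].
Proof.
have [C HC] : exists C, forall s, normc (hat1 f s) <= C.
  by rewrite hat1E; exact/L1hat_bounded/weight_cintegrable/low_weight_intble.
have C0 : 0 <= C by exact: le_trans (normc_ge0 _) (HC 0).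
have d1 := cder_oriented (hat1_continuous f); have d0 := cder_Omega f.
have O1 s : normc (Omega1 f s) <= 2 * C * `|s|.
  rewrite (le_trans (normc_le_ReIm _))// mulr2n !mulrDl !mul1r lerD//.
  - have [z _ e'] := MVT0 s (fun x => (d1 x).1)
      (congr1 (@complex.Re R) (oriented_Cintegral0 _)).
    rewrite (_ : Re (Omega1 f s) = s * Re (hat1 f z)); last exact: e'.
    by rewrite normrM mulrC ler_wpM2r// (le_trans (normRe _))//; exact: HC.
  - have [z _ e'] := MVT0 s (fun x => (d1 x).2)
      (congr1 (@complex.Im R) (oriented_Cintegral0 _)).
    rewrite (_ : Im (Omega1 f s) = s * Im (hat1 f z)); last exact: e'.
    by rewrite normrM mulrC ler_wpM2r// (le_trans (normIm _))//; exact: HC.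
have O0 s : normc (Omega f s) <= 4 * C * `|s| ^+ 2.
  have e : 4 * C * `|s| ^+ 2 = `|s| * (2 * C * `|s|) + `|s| * (2 * C * `|s|) by ring.
  rewrite (le_trans (normc_le_ReIm _))// e lerD//.
  - have [z zs e'] := MVT0 s (fun x => (d0 x).1)
      (congr1 (@complex.Re R) (oriented_Cintegral0 _)).
    rewrite (_ : Re (Omega f s) = s * Re (Omega1 f z)); last exact: e'.
    rewrite normrM ler_wpM2l// (le_trans (normRe _))// (le_trans (O1 z))//.
    by rewrite ler_wpM2l// mulr_ge0.
  - have [z zs e'] := MVT0 s (fun x => (d0 x).2)
      (congr1 (@complex.Im R) (oriented_Cintegral0 _)).
    rewrite (_ : Im (Omega f s) = s * Im (Omega1 f z)); last exact: e'.
    rewrite normrM ler_wpM2l// (le_trans (normIm _))// (le_trans (O1 z))//.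
    by rewrite ler_wpM2l// mulr_ge0.
(* The constant for [Omega] serves all three: in particular [2 |s| <= 1 + s^2], from the square of
   [1 - |s|]. *)
exists (4 * C); split => s.
- rewrite (le_trans (HC s))//.
  have := mulr_ge0 C0 (sqr_ge0 s); have := C0; nra.
- rewrite (le_trans (O1 s))//.
  rewrite -(real_normK (num_real s)).
  have : 0 <= C * (1 - `|s|) ^+ 2 by rewrite mulr_ge0// sqr_ge0.
  have := mulr_ge0 C0 (sqr_ge0 `|s|); have := C0; nra.
- by rewrite (le_trans (O0 s))// real_normK ?num_real// ler_wpM2l ?mulr_ge0// lerDr.
Qed.

End distribution.

(** * The Fourier transform of essentially bounded functions *)

Section fourier_facts.
Context {R : realType}.
Local Notation mu := (@lebesgue_measure R).
Local Notation intble f := (mu.-integrable [set: R] (EFin \o f)).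
Local Notation Re := complex.Re.
Local Notation Im := complex.Im.
Local Notation gauss c x := (expR (- (c * x ^+ 2))).
Implicit Types (f g : Linf R) (phi : schwartz R).

Lemma Phi_continuous f : ccontinuous (Phi f).
Proof.
exact: (ccontinuousB (cder_continuous (cder_Omega f)) (Psi_continuous f)).
Qed.

Lemma Psi_growth f : exists C : R, forall s, normc (Psi f s) <= C * (1 + s ^+ 2).
Proof.
have [C HC] : exists C, forall s, normc (Psi f s) <= C.
  by rewrite PsiE; exact/L1hat_bounded/weight_cintegrable/high_weight_intble.
exists C => s; rewrite (le_trans (HC s))// ler_peMr ?lerDl ?sqr_ge0//.
exact: le_trans (normc_ge0 _) (HC 0).
Qed.

Lemma Phi_growth f : exists C : R, forall s, normc (Phi f s) <= C * (1 + s ^+ 2).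
Proof.
have [C [_ _ HC]] := Omega_growth f; have [D HD] := Psi_growth f.
exists (C + D) => s; rewrite mulrDl -[Phi f s]/(Omega f s - Psi f s).
by rewrite (le_trans (le_normcD _ _))// normcN lerD.
Qed.

Lemma fourier_Phi f phi : fourier f phi =
  Cintegral setT (fun s => Phi f s * schwartz_derive (schwartz_derive phi) s).
Proof.
set p2 := schwartz_derive (schwartz_derive phi).
have [C [_ _ HC]] := Omega_growth f; have [D HD] := Psi_growth f.
have iO := growth_schwartz_cintegrable p2
  (ccontinuous_meas (cder_continuous (cder_Omega f))) HC.
have iP := growth_schwartz_cintegrable p2 (ccontinuous_meas (Psi_continuous f)) HD.
transitivity (Cintegral setT (fun s => Omega f s * p2 s) -
              Cintegral setT (fun s => Psi f s * p2 s)); first by [].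
rewrite -(CintegralB iO iP); congr Cintegral; apply/funext => s.
by rewrite -mulrBl.
Qed.

Lemma fourier_pairing f phi : fourier f phi = pairing f (schwartz_fourier phi).
Proof.
set p2 := schwartz_derive (schwartz_derive phi).
pose lo t := (low_weight t)%:C * f t; pose hi t := (high_weight t)%:C * f t.
have il : cintegrable lo := weight_cintegrable f low_weight_intble.
have ih : cintegrable hi := weight_cintegrable f high_weight_intble.
have [C [b2 b1 b0]] := Omega_growth f.
have E1 : Cintegral setT (fun s => Omega f s * p2 s) =
    Cintegral setT (fun t => lo t * L1hat phi t).
  rewrite (Cintegral_parts2 phi (cder_Omega f) (cder_oriented (hat1_continuous f))
    (hat1_continuous f) b0 b1 b2).
  have [<- _] := L1hat_mul (schwartz_cintegrable phi) il.
  by congr Cintegral; apply/funext => s; rewrite hat1E mulrC.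
have E2 : Cintegral setT (fun s => Psi f s * p2 s) =
    Cintegral setT (fun t => hi t * L1hat p2 t).
  have [<- _] := L1hat_mul (schwartz_cintegrable p2) ih.
  by congr Cintegral; apply/funext => s; rewrite PsiE mulrC.
have [_ i1] := L1hat_mul il (schwartz_cintegrable phi).
have [_ i2] := L1hat_mul ih (schwartz_cintegrable p2).
transitivity (Cintegral setT (fun s => Omega f s * p2 s) -
              Cintegral setT (fun s => Psi f s * p2 s)); first by [].
rewrite E1 E2 -(CintegralB i1 i2); congr Cintegral; apply/funext => t.
(* The sign of [-t^2] cancels the minus in front of the [Psi] term, so the weights add up to
   [low_weight t + high_weight t * t^2 = 1]. *)
rewrite L1hat_derive2 -[schwartz_fourier phi t]/(L1hat phi t) /lo /hi.
have E (a b c x y : R[i]) : a * x * y - b * x * (- c * y) = (a + b * c) * (x * y) by ring.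
by rewrite E -rmorphM -rmorphD weightsE mul1r.
Qed.

Lemma schwartz_derive_lin (a : R[i]) phi psi :
  schwartz_derive (a *: phi + psi) = a *: schwartz_derive phi + schwartz_derive psi.
Proof.
apply/val_inj => /=; apply: Cderive_lin => x.
- by have [d _] := is_schwartzP phi; exact: (d 0%N x).
- by have [d _] := is_schwartzP psi; exact: (d 0%N x).
Qed.

Lemma fourier_tempered_lin f (a : R[i]) phi psi :
  fourier f (a *: phi + psi) = a * fourier f phi + fourier f psi.
Proof.
rewrite !fourier_Phi !schwartz_derive_lin.
set p := schwartz_derive (schwartz_derive phi); set q := schwartz_derive _.
have [C HC] := Phi_growth f; have mP := ccontinuous_meas (Phi_continuous f).
have ip := growth_schwartz_cintegrable p mP HC.
have iq := growth_schwartz_cintegrable q mP HC.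
rewrite -(CintegralZ a ip) -(CintegralD (cintegrableZ a ip) iq).
congr Cintegral; apply/funext => s.
have -> : (a *: p + q : schwartz R) s = a * p s + q s by [].
by rewrite mulrDr mulrCA.
Qed.

(** [Phi f] grows at most like [1 + x^2] and [phi''] decays like its inverse square, with a constant
    linear in the two seminorms supplied by [schwartz_decay]. *)
Lemma fourier_seminorm_bound f : exists K : R, forall phi,
  normc (fourier f phi) <= K * (schwartz_seminorm 0 2 phi + schwartz_seminorm 4 2 phi).
Proof.
have [C HC] := Phi_growth f; have mP := ccontinuous_meas (Phi_continuous f).
pose I := \int[mu]_x (1 + x ^+ 2)^-1.
exists (2 * (C * 2 * I)) => phi; rewrite fourier_Phi.
set S := _ + _; set p := schwartz_derive _.
have b := growth_mul_decay (phi := p) HC (schwartz_decay phi 2).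
have -> : 2 * (C * 2 * I) * S = 2 * \int[mu]_x (C * (2 * S) * (1 + x ^+ 2)^-1).
  by rewrite RintegralZl//; [rewrite -/I; ring|exact: intble_oneDsqrV].
apply: normc_Cintegral.
- by have /cintegrable_meas := growth_schwartz_cintegrable p mP HC.
- exact/intbleZ/intble_oneDsqrV.
- exact: b.
Qed.

Lemma fourier_tempered f : is_tempered (fourier f).
Proof.
split=> [|u phi uphi]; first exact: fourier_tempered_lin.
have [K HK] := fourier_seminorm_bound f.
have d k : normc (fourier f (u k) - fourier f phi) <=
    K * (schwartz_seminorm 0 2 (u k - phi) + schwartz_seminorm 4 2 (u k - phi)).
  have e : u k - phi = -1 *: phi + u k by rewrite scaleN1r addrC.
  have := HK (u k - phi).
  by rewrite [in X in X -> _]e fourier_tempered_lin mulN1r -e addrC.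
have z : K * (schwartz_seminorm 0 2 (u k - phi) + schwartz_seminorm 4 2 (u k - phi))
    @[k --> \oo] --> (0 : R).
  rewrite -[X in _ --> X](mulr0 K) -[X in _ --> K * X](addr0 0).
  by apply: cvgMr; apply: cvgD; exact: uphi.
apply: (squeeze_cvgr _ (cvg_cst 0) z); apply: nearW => k.
by rewrite normc_ge0 d.
Qed.

Lemma fourier_lin (a : R[i]) f g : fourier (a *: f + g) = a *: fourier f + fourier g.
Proof.
apply/funext => phi.
rewrite -[RHS]/(a * fourier f phi + fourier g phi) !fourier_Phi Phi_lin.
set p := schwartz_derive _.
have [C HC] := Phi_growth f; have [D HD] := Phi_growth g.
have i1 := growth_schwartz_cintegrable p (ccontinuous_meas (Phi_continuous f)) HC.
have i2 := growth_schwartz_cintegrable p (ccontinuous_meas (Phi_continuous g)) HD.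
rewrite -(CintegralZ a i1) -(CintegralD (cintegrableZ a i1) i2).
congr Cintegral; apply/funext => s.
rewrite -[(a *: Phi f + Phi g) s]/(a * Phi f s + Phi g s).
by rewrite mulrDl mulrA.
Qed.

(** The wave [exp (i b s) exp (-c s^2)], in components so that each part lies in
    [gauss_span c b]. *)
Definition gauss_wave (c b s : R) : R[i] :=
  (cos (b * s) * gauss c s) +i* (sin (b * s) * gauss c s).

Lemma gauss_wave_schwartz c b : 0 < c -> is_schwartz (gauss_wave c b).
Proof.
move=> c0.
have H n : exists p q, [/\ gauss_span c b p, gauss_span c b q &
    iter n Cderive (gauss_wave c b) = fun s => p s +i* q s].
  elim: n => [|n [p [q [sp sq e]]]].
    by exists (fun s => cos (b * s) * gauss c s), (fun s => sin (b * s) * gauss c s);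
      split => //; [exact: gs_cos|exact: gs_sin].
  have [p' sp' dp] := gauss_span_derive sp; have [q' sq' dq] := gauss_span_derive sq.
  exists p', q'; split => //; rewrite iterS e; apply/funext => s.
  apply: complexP; rewrite /Cderive [LHS]derive1E.
  - by have [_ <-] := dp s.
  - by have [_ <-] := dq s.
split=> [n x|m n]; have [p [q [sp sq ->]]] := H n.
- have [p' _ dp] := gauss_span_derive sp; have [q' _ dq] := gauss_span_derive sq.
  by split; [have [] := dp x|have [] := dq x].
- have [M HM] := gauss_span_rapid c0 sp m; have [N HN] := gauss_span_rapid c0 sq m.
  exists (M + N) => x.
  apply: (@le_trans _ _ (`|x| ^+ m * (`|p x| + `|q x|))).
    by rewrite ler_wpM2l ?exprn_ge0//; exact: normc_le_ReIm.
  by rewrite mulrDr; apply: lerD; [exact: HM|exact: HN].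
Qed.

Lemma gauss_wave_hat c b t : 0 < c ->
  L1hat (gauss_wave c b) t = ((\int[mu]_s gauss c s) * gauss (4 * c)^-1 (t - b))%:C.
Proof.
(* The addition formulas produce the frequency [b - t]; the square hides the change of sign. *)
move=> c0; rewrite -(sqrrN (t - b)) opprB; apply: complexP => /=.
- rewrite -(gauss_cos_integral c0); apply: eq_Rintegral => s _.
  rewrite /reF ReM /= (_ : (b - t) * s = b * s - s * t); last by ring.
  by rewrite cosB cosN sinN; ring.
- rewrite -[RHS](gauss_sin_integral c0 (b - t)); apply: eq_Rintegral => s _.
  rewrite /imF ImM /= (_ : (b - t) * s = b * s - s * t); last by ring.
  by rewrite sinB cosN sinN; ring.
Qed.

Lemma fourier_eq0 f : fourier f = (fun=> 0) -> f = 0.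
Proof.
move=> f0; have [h [mh hM] fh] := Linf_rep f.
have key (c b : R) : 0 < c ->
    Cintegral setT (fun t => h t * (gauss c (t - b))%:C) = 0.
  (* Testing with width parameter [(4 c)^-1] yields a transform with parameter exactly [c], since
     [c |-> (4 c)^-1] is an involution. *)
  move=> c0; have c4 : 0 < (4 * c)^-1 by rewrite invr_gt0 mulr_gt0.
  have P : gauss_wave (4 * c)^-1 b \in schwartz_pred.
    by apply/asboolP; exact: gauss_wave_schwartz.
  have := fourier_pairing f (Schwartz P); rewrite f0.
  set K := \int[mu]_s gauss (4 * c)^-1 s.
  have K0 : K%:C != 0 :> R[i].
    apply/eqP => /(congr1 (@complex.Re R)) /= K0.
    by have := gauss_integral_gt0 c4; rewrite -/K K0 ltxx.
  have cc : (4 * (4 * c)^-1)^-1 = c by field; rewrite gt_eqF.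
  have hatE t : schwartz_fourier (Schwartz P) t = (K * gauss c (t - b))%:C.
    by rewrite -[LHS]/(L1hat _ t) gauss_wave_hat// cc.
  have ig : cintegrable (fun t => (gauss c (t - b))%:C).
    apply: (@cintegrable_dom _ _ (fun t => gauss c (- b + 1 * t))).
    + apply: cmeasurable_real; apply: measurableT_comp => //.
      apply: measurableT_comp => //; apply: measurable_funM => //.
      by apply: measurable_funX; exact: measurable_funB.
    + exact: (intble_affine _ ltr01 (gauss_intble c0)).
    + by move=> t; rewrite normc_real ger0_norm ?expR_ge0// mul1r addrC.
  have ihg : cintegrable (fun t => h t * (gauss c (t - b))%:C).
    exact: cintegrableMb ig mh hM.
  rewrite (_ : pairing _ _ = K%:C * Cintegral setT (fun t => h t * (gauss c (t - b))%:C)).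
    by move/esym/eqP; rewrite mulf_eq0 (negPf K0)/= => /eqP.
  rewrite -(CintegralZ _ ihg) /pairing; apply: Cintegral_ae_eq.
  - apply: (cmeasurableM (Linf_meas f)).
    rewrite (_ : schwartz_fourier _ = fun t => K%:C * (gauss c (t - b))%:C).
      exact: cintegrable_meas (cintegrableZ _ ig).
    by apply/funext => t; rewrite hatE rmorphM.
  - exact: cintegrable_meas (cintegrableZ _ ihg).
  - by apply: filterS fh => t ->; rewrite hatE rmorphM mulrCA.
have [m1 m2] := mh.
(* The Gaussian weights are real, so the orthogonality relations split into one for each component
   of [h]. *)
have R0 : \forall x \ae mu, reF h x = 0.
  apply: (gauss_orthogonal_eq0 m1 (M := Linf_norm f)) => [x|c b c0].
    exact: le_trans (normRe _) (hM x).
  have := congr1 (@complex.Re R) (key c b c0); rewrite /= => <-.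
  by apply: eq_Rintegral => t _; rewrite /reF ReM /= mulr0 subr0.
have I0 : \forall x \ae mu, imF h x = 0.
  apply: (gauss_orthogonal_eq0 m2 (M := Linf_norm f)) => [x|c b c0].
    exact: le_trans (normIm _) (hM x).
  have := congr1 (@complex.Im R) (key c b c0); rewrite /= => <-.
  by apply: eq_Rintegral => t _; rewrite /imF ImM /= mulr0 add0r.
apply: Linf_ext; apply: filterS (filterI (filterI R0 I0) (filterI fh Linf0)).
move=> x /= [[r0 i0] [-> ->]]; exact: complexP.
Qed.

Lemma fourier_inj f g : fourier f = fourier g -> f = g.
Proof.
move=> fg; have h : fourier (-1 *: g + f) = (fun=> 0).
  by rewrite fourier_lin fg scaleN1r addNr.
by have /eqP := fourier_eq0 h; rewrite scaleN1r addrC subr_eq0 => /eqP.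
Qed.

Lemma Phi_inj f g : Phi f = Phi g -> f = g.
Proof.
by move=> fg; apply: fourier_inj; apply/funext => phi; rewrite !fourier_Phi fg.
Qed.

Lemma A_normE f : A_norm (fourier f) = Linf_norm f.
Proof.
congr Linf_norm; apply: fourier_inj.
exact: (@xgetPex _ 0 [set g | fourier g = fourier f] (ex_intro _ f erefl)).
Qed.

Lemma B_normE f : B_norm (Phi f) = Linf_norm f.
Proof.
congr Linf_norm; apply: Phi_inj.
exact: (@xgetPex _ 0 [set g | Phi g = Phi f] (ex_intro _ f erefl)).
Qed.

Lemma fourier_isometry : isometric_isomorphism [set: Linf R] (@Linf_norm R)
  (@A_inf R) (@A_norm R) (@fourier R).
Proof.
split=> [a f g _ _||f _]; [exact: fourier_lin| |exact: A_normE].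
split=> [f _|f g _ _|T [f _ <-]]; [by exists f|exact: fourier_inj|by exists f].
Qed.

Lemma Phi_isometry : isometric_isomorphism [set: Linf R] (@Linf_norm R)
  (@B_inf R) (@B_norm R) (@Phi R).
Proof.
split=> [a f g _ _||f _]; [exact: Phi_lin| |exact: B_normE].
split=> [f _|f g _ _|T [f _ <-]]; [by exists f|exact: Phi_inj|by exists f].
Qed.

End fourier_facts.

Theorem theorem3p1 (R : realType) :
  [/\ (forall (f : Linf R) (phi : schwartz R),
         fourier f phi = pairing f (schwartz_fourier phi)),
      [/\ (forall f : Linf R, is_tempered (fourier f)),
          (forall f : Linf R, A_norm (fourier f) = Linf_norm f),
          normed_space (@A_inf R) (@A_norm R) &
          isometric_isomorphism [set: Linf R] (@Linf_norm R)
            (@A_inf R) (@A_norm R) (@fourier R)] &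
      [/\ (forall f : Linf R, B_norm (Phi f) = Linf_norm f),
          [/\ banach_space [set: Linf R] (@Linf_norm R),
              banach_space (@A_inf R) (@A_norm R) &
              banach_space (@B_inf R) (@B_norm R)] &
          [/\ isometrically_isomorphic [set: Linf R] (@Linf_norm R)
                (@A_inf R) (@A_norm R),
              isometrically_isomorphic [set: Linf R] (@Linf_norm R)
                (@B_inf R) (@B_norm R) &
              isometrically_isomorphic (@A_inf R) (@A_norm R)
                (@B_inf R) (@B_norm R)]]].
Proof.
have isoA := @fourier_isometry R; have isoB := @Phi_isometry R.
have BA := banach_isometric (@Linf_banach R) isoA.
have BB := banach_isometric (@Linf_banach R) isoB.
split.
- exact: fourier_pairing.
- split; [exact: fourier_tempered|exact: A_normE|exact: BA.1|exact: isoA].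
- split; [exact: B_normE|split; [exact: Linf_banach|exact: BA|exact: BB]|].
  split; [by exists (@fourier R)|by exists (@Phi R)|exact: isometric_trans isoA isoB].
Qed.
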